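(* Let $x\in\mathscr M^{loc}_+$ correspond to a potential $X$, i.e. $$x(f)=-\mathop{\mathrm{LIM}}_{d\in\mathscr D}\ P\int\mathscr P^d(f)\,dX\qquad\text{for all } f\in\mathfrak B(\bar{\mathscr F}),$$ and define the set function $x_{\mathscr F}$ on $\mathscr F$ by $$x_{\mathscr F}(F)=x(F\times\Delta),\qquad F\in\mathscr F.$$ Then $x_{\mathscr F}\ll P$ if and only if there exist $M\in L^1_+$ and an increasing, integrable, natural process $A$ such that $$X_\delta=P(M|\mathscr F_\delta)-A_\delta\qquad P\text{-a.s., for each } \delta\in\Delta.$$ This decomposition is unique (up to modification).
   Context: Setting. $(\Omega,\mathscr F,P)$ is a probability space, $P(\cdot)$ also denotes expectation and $P(\cdot|\mathscr G)$ conditional expectation. $\Delta$ is a linearly ordered set and $(\mathscr F_\delta:\delta\in\Delta)$ an increasing family of sub $\sigma$-algebras of $\mathscr F$ (no right continuity assumed); all $\sigma$-algebras include the corresponding $P$-null sets. $\bar\Omega=\Omega\times\Delta$; $\bar{\mathscr F}$ is the augmentation of $\mathscr F\otimes 2^\Delta$ with respect to sets with $P$-null projection on $\Omega$. $\mathfrak B(\cdot)$ denotes bounded measurable functions; $L^1_+$ is the set of nonnegative elements of $L^1(\Omega,\mathscr F,P)$. $]\delta_1,\delta_2]=\{\delta\in\Delta:\delta_1<\delta\le\delta_2\}$ (possibly empty), also identified with $\Omega\times]\delta_1,\delta_2]$. All processes $X=(X_\delta:\delta\in\Delta)$ are adapted. Two processes are considered equal (up to modification) if $P(X_\delta=Y_\delta)=1$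 for all $\delta$; uniqueness of decompositions is understood in this sense. $\mathscr D$ is the collection of finite subsets $d=\{\delta_1\le\ldots\le\delta_{N+1}\}$ of $\Delta$, directed by inclusion. $\mathscr P^d=\{\bigcup_{n=1}^N F_n\times]\delta_n,\delta_{n+1}]:F_n\in\mathscr F_{\delta_n}\}$; $\mathfrak B(\mathscr P^d)$ consists of $h=\sum_{n=1}^Nh_n\mathbf 1_{]\delta_n,\delta_{n+1}]}$ with $h_n\in\mathfrak B(\mathscr F_{\delta_n})$; $\mathscr E=\bigcup_{d\in\mathscr D}\mathfrak B(\mathscr P^d)$; for such $h$, $\int h\,dX=\sum_nh_n(X_{\delta_{n+1}}-X_{\delta_n})$. $\mathscr P^d$ also denotes the operator $\mathscr P^d:\mathfrak B(\bar{\mathscr F})\to\mathfrak B(\mathscr P^d)$, $\mathscr P^d(U)=\sum_{n=1}^NP(U_{\delta_{n+1}}|\mathscr F_{\delta_n})\mathbf 1_{]\delta_n,\delta_{n+1}]}$; a random variable $b\in L^\infty(\mathscr F)$ is treated as a process constant in $\delta$, so $\mathscr P^d(b)=\sum_nP(b|\mathscr F_{\delta_n})\mathbf 1_{]\delta_n,\delta_{n+1}]}$. $\mathrm{LIM}_{d\in\mathscr D}$ is a fixed Banach limit on bounded nets indexed by $\mathscr D$ (a positive linear functional extending the ordinary limit). A process $A$ is increasing if $P(0\le A_{\delta_1}\le A_{\delta_2})=1$ for all $\delta_1\le\delta_2$ and $\inf_{\delta\in\Delta}P(A_\delta)=0$; a process is integrable if $\sup_\delta P(|A_\delta|)<\infty$.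 An increasing process $A$ is natural if $$P\Big(b\int f\,dA\Big)=\mathop{\mathrm{LIM}}_{d\in\mathscr D}\ P\int\mathscr P^d(b)f\,dA\qquad\text{for all } b\in L^\infty(\mathscr F),\ f\in\mathscr E.$$ The $d$-variation of $X$ is $V^d(X)=\sum_{n=1}^N|X_{\delta_n}-P(X_{\delta_{n+1}}|\mathscr F_{\delta_n})|$; $X$ is a quasi-martingale if $\sup_{d\in\mathscr D}P(V^d(X))<\infty$. A quasi-potential is a quasi-martingale $X$ for which there is a sequence $(\delta_n)_{n\in\mathbb N}$ in $\Delta$ such that $\lim_nP(|X_{\bar\delta_n}|)=0$ for every sequence $(\bar\delta_n)$ with $\bar\delta_n\ge\delta_n$ for all $n$. A potential is a process that is both a quasi-potential and a positive supermartingale. $ba(\bar{\mathscr F})$ is the space of bounded finitely additive measures on $\bar{\mathscr F}$, $x(f)$ denoting the integral of $f$. $\mathscr M^{loc}$ is the set of $x\in ba(\bar{\mathscr F})$ whose restriction to $\mathscr P^d$ is countably additive for each $d\in\mathscr D$; $\mathscr M^{loc}_+$ is the set of its nonnegative elements. For a finitely additive $\mu\ge0$ on $\mathscr F$, $\mu\ll P$ means absolute continuity in the sense of finitely additive measures: for every $\varepsilon>0$ there is $\eta>0$ such that $P(F)<\eta$ implies $\mu(F)<\varepsilon$. *)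

(* Defs.v *)
From mathcomp Require Import all_boot all_order all_algebra finmap.
From mathcomp Require Import all_classical all_reals all_analysis.
From mathcomp.analysis.showcase Require summability.
Import Order.TTheory GRing.Theory Num.Theory.
Import numFieldNormedType.Exports.

Set Implicit Arguments.
Unset Strict Implicit.
Unset Printing Implicit Defensive.

Local Open Scope classical_set_scope.
Local Open Scope ring_scope.

Section measurability.
Context {R : realType} {U : Type}.

(* [G] is meant to be a sigma-algebra.  No [measurableType] structure is put on
   [U], because the carrier [Omega x Delta] below need not be pointed. *)
Definition measurable_wrt (G : set (set U)) (f : U -> R) :=
  forall B : set R, measurable B -> G (f @^-1` B).

Definition bounded_measurable (G : set (set U)) (f : U -> R) :=
  measurable_wrt G f /\ bounded_fun f.

End measurability.

Section finitely_additive.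
Context {R : realType} {U : Type}.
Variables (G : set (set U)) (x : set U -> R).

(* Only the values of [x] on [G] are meaningful. *)
Definition is_ba :=
  (forall A B, G A -> G B -> A `&` B = set0 -> x (A `|` B) = x A + x B) /\
  (exists C : R, forall A, G A -> `|x A| <= C).

Definition ba_simple_integral (s : U -> R) : R :=
  \sum_(v \in range s) v * x (s @^-1` [set v]).

(* For [x] in ba(G) and [f] bounded and [G]-measurable, [ba_integral f] is the
   limit of the integrals of simple functions tending to [f] uniformly. *)
Definition is_ba_integral (f : U -> R) (I : R) :=
  forall e : R, 0 < e -> exists2 r : R, 0 < r &
    forall s : U -> R, measurable_wrt G s -> finite_set (range s) ->
      (forall w, `|f w - s w| <= r) -> `|ba_simple_integral s - I| <= e.

Definition ba_integral (f : U -> R) : R := get (is_ba_integral f).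

Definition countably_additive_on (H : set (set U)) :=
  forall B : nat -> set U, (forall k, H (B k)) -> trivIset setT B ->
    H (\bigcup_k B k) ->
    (fun n => \sum_(0 <= k < n) x (B k)) @ \oo --> x (\bigcup_k B k).

End finitely_additive.

Section banach_limit.
Context {R : realType} {disp : Order.disp_t} {Delta : orderType disp}.

(* [summability.totally] is the filter of eventual properties of finite subsets
   of [Delta] directed by inclusion. *)
Record banach_limit (LIM : ({fset Delta} -> R) -> R) : Prop := BanachLimit {
  banach_limit_linear : forall (a : R) (u v : {fset Delta} -> R),
    bounded_fun u -> bounded_fun v ->
    LIM (fun d => a * u d + v d) = a * LIM u + LIM v ;
  banach_limit_ge0 : forall u : {fset Delta} -> R,
    bounded_fun u -> (forall d, 0 <= u d) -> 0 <= LIM u ;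
  banach_limit_cvg : forall (u : {fset Delta} -> R) (l : R), bounded_fun u ->
    u @ summability.totally --> l -> LIM u = l }.

End banach_limit.

Section grids.
Context {disp : Order.disp_t} {Delta : orderType disp}.

(* The pairs (delta_n, delta_(n+1)), 1 <= n <= N, of the increasing enumeration
   delta_1 < ... < delta_(N+1) of [d]. *)
Definition steps (d : {fset Delta}) : seq (Delta * Delta) :=
  let s := sort <=%O (enum_fset d) in zip s (behead s).

Definition ocitv (p : Delta * Delta) : set Delta := [set` `]p.1, p.2]].

Lemma sum_steps_indic {R : realType} (d : {fset Delta})
    (c : Delta * Delta -> R) (p : Delta * Delta) :
  p \in steps d ->
  \sum_(q <- steps d) c q * \1_(ocitv q) p.2 = c p.
Proof.
have mem_zip (l m : seq Delta) q :
    q \in zip l m -> q.1 \in l /\ q.2 \in m.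
  elim: l m => [|u l IH] [|v m]//=; rewrite !inE.
  by move=> /predU1P[->/=|/IH[-> ->]]; rewrite ?eqxx ?orbT.
rewrite /steps; set s := sort _ _.
have : sorted <%O s.
  by rewrite lt_sorted_uniq_le sort_uniq fset_uniq sort_le_sorted.
elim: s => // a [//|b s] IH; rewrite /= => /andP[ab bs].
have lo q : q \in zip (b :: s) s -> (b <= q.1)%O /\ (b < q.2)%O.
  move=> qs; have [q1 q2] : q.1 \in b :: s /\ q.2 \in s.
    exact: mem_zip.
  move: bs; rewrite lt_path_sortedE => /andP[/allP bs _]; split; last exact: bs.
  by move: q1; rewrite inE => /predU1P[->//|/bs /ltW].
rewrite big_cons inE => /predU1P[->|ps].
- rewrite indicE mem_set/= ?mulr1; last by rewrite /ocitv/= in_itv/= ab lexx.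
  rewrite big_seq big1 ?addr0// => q /lo[bq _].
  rewrite indicE memNset ?mulr0// /ocitv/= in_itv/= => /andP[].
  by rewrite ltNge bq.
- rewrite indicE memNset ?mulr0 ?add0r; first exact: IH.
  by rewrite /ocitv/= in_itv/= => /andP[_]; rewrite leNgt (lo _ ps).2.
Qed.

End grids.

Section processes.
Context {R : realType} {dT : measure_display} {T : measurableType dT}.
Context {disp : Order.disp_t} {Delta : orderType disp}.
Variable P : probability T R.

Definition mean (Y : T -> R) : R := fine ('E_P[Y])%E.

Definition filtration (F : Delta -> set (set T)) :=
  [/\ forall s, sigma_algebra setT (F s),
      forall s, F s `<=` measurable,
      forall s t, (s <= t)%O -> F s `<=` F t &
      forall s, P.-negligible `<=` F s].

Definition is_condexp (G : set (set T)) (Y Z : T -> R) :=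
  [/\ measurable_wrt G Z,
      Z \in Lfun P 1%:E &
      forall B, G B ->
        (\int[P]_(w in B) (Z w)%:E = \int[P]_(w in B) (Y w)%:E)%E].

(* A version of P(Y|G), chosen once and for all; it is [0] when [Y] has
   no conditional expectation. *)
Definition condexp (G : set (set T)) (Y : T -> R) : T -> R :=
  xget (fun=> 0) (is_condexp G Y).

Definition barF : set (set (T * Delta)) :=
  <<s [set C | exists (A : set T) (D : set Delta),
               measurable A /\ C = A `*` D]
      `|` [set N | P.-negligible (fst @` N)] >>.

Variable F : Delta -> set (set T).

Definition adapted (X : Delta -> T -> R) := forall s, measurable_wrt (F s) (X s).

Definition modification (X Y : Delta -> T -> R) :=
  forall s, P [set w | X s w = Y s w] = 1%E.

Definition pred_sets (d : {fset Delta}) : set (set (T * Delta)) :=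
  [set B | exists2 A : Delta -> set T,
     (forall p, p \in steps d -> F p.1 (A p.1)) &
     B = \bigcup_(p in [set` steps d]) (A p.1 `*` ocitv p)].

Definition pred_fun (d : {fset Delta}) : set (T * Delta -> R) :=
  [set h | exists2 c : Delta -> T -> R,
     (forall p, p \in steps d -> bounded_measurable (F p.1) (c p.1)) &
     h = fun w => \sum_(p <- steps d) c p.1 w.1 * \1_(ocitv p) w.2].

(* For h = \sum_n h_n 1_]delta_n, delta_(n+1)] the coefficient h_n is the value
   of h at time delta_(n+1), so that this is
   \sum_n h_n (X_delta_(n+1) - X_delta_n): see [sint_pred_fun]. *)
Definition sint (d : {fset Delta}) (h : T * Delta -> R)
    (X : Delta -> T -> R) : T -> R :=
  fun w => \sum_(p <- steps d) h (w, p.2) * (X p.2 w - X p.1 w).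

Lemma sint_pred_fun (d : {fset Delta}) (c : Delta -> T -> R)
    (X : Delta -> T -> R) (w : T) :
  sint d (fun v => \sum_(p <- steps d) c p.1 v.1 * \1_(ocitv p) v.2) X w =
  \sum_(p <- steps d) c p.1 w * (X p.2 w - X p.1 w).
Proof.
rewrite /sint [LHS]big_seq [RHS]big_seq; apply: eq_bigr => p pd /=.
by rewrite (sum_steps_indic (fun q => c q.1 w) pd).
Qed.

Definition pred_proj (d : {fset Delta}) (U : T * Delta -> R) :
    T * Delta -> R :=
  fun w => \sum_(p <- steps d)
    condexp (F p.1) (fun o => U (o, p.2)) w.1 * \1_(ocitv p) w.2.

Definition variation (d : {fset Delta}) (X : Delta -> T -> R) : T -> R :=
  fun w => \sum_(p <- steps d) `|X p.1 w - condexp (F p.1) (X p.2) w|.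

Definition quasi_martingale (X : Delta -> T -> R) :=
  [/\ adapted X,
      forall s, X s \in Lfun P 1%:E &
      (ereal_sup (range (fun d => 'E_P[variation d X])) < +oo)%E].

Definition quasi_potential (X : Delta -> T -> R) :=
  quasi_martingale X /\
  exists s_ : nat -> Delta, forall t_ : nat -> Delta,
    (forall n, (s_ n <= t_ n)%O) ->
    ('E_P[(fun w => `|X (t_ n) w|)%R] @[n --> \oo] --> 0)%E.

Definition supermartingale (X : Delta -> T -> R) :=
  [/\ adapted X,
      forall s, X s \in Lfun P 1%:E &
      forall s t, (s <= t)%O ->
        {ae P, forall w, condexp (F s) (X t) w <= X s w}].

Definition positive (X : Delta -> T -> R) :=
  forall s, {ae P, forall w, 0 <= X s w}.

Definition potential (X : Delta -> T -> R) :=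
  [/\ quasi_potential X, positive X & supermartingale X].

Definition increasing_process (A : Delta -> T -> R) :=
  [/\ adapted A,
      forall s t, (s <= t)%O -> P [set w | 0 <= A s w <= A t w] = 1%E &
      ereal_inf (range (fun s => 'E_P[A s])%E) = 0%E].

Definition integrable_process (A : Delta -> T -> R) :=
  (ereal_sup (range (fun s => 'E_P[(fun w => `|A s w|)%R])) < +oo)%E.

(* When f is in B(P^d0), the integrand P^d(b) f need not be in B(P^d); up to
   P-null sets it is in B(P^(d `|` d0)), and there its integral is taken. *)
Definition natural (LIM : ({fset Delta} -> R) -> R) (A : Delta -> T -> R) :=
  forall (b : T -> R) (d0 : {fset Delta}) (f : T * Delta -> R),
    b \in Lfun P +oo%E -> pred_fun d0 f ->
    mean (fun w => b w * sint d0 f A w) =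
    LIM (fun d => mean (sint (d `|` d0)%fset
           (fun w => pred_proj d (fun v => b v.1) w * f w) A)).

Definition Mloc (x : set (T * Delta) -> R) :=
  is_ba barF x /\ forall d, countably_additive_on x (pred_sets d).

Definition Mloc_pos (x : set (T * Delta) -> R) :=
  Mloc x /\ forall B, barF B -> 0 <= x B.

Definition corresponds (LIM : ({fset Delta} -> R) -> R)
    (x : set (T * Delta) -> R) (X : Delta -> T -> R) :=
  forall f, bounded_measurable barF f ->
    ba_integral barF x f =
    - LIM (fun d => mean (sint d (pred_proj d f) X)).

Definition restrF (x : set (T * Delta) -> R) : set T -> R :=
  fun A => x (A `*` setT).

(* Not the library's [`<<], which only compares null sets and is weaker for
   finitely additive [mu]. *)
Definition fa_abs_continuous (mu : set T -> R) :=
  forall e : R, 0 < e -> exists2 eta : R, 0 < eta &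
    forall A, measurable A -> (P A < eta%:E)%E -> mu A < e.

Definition doob_meyer (LIM : ({fset Delta} -> R) -> R) (X : Delta -> T -> R)
    (M : T -> R) (A : Delta -> T -> R) :=
  [/\ M \in Lfun P 1%:E /\ {ae P, forall w, 0 <= M w},
      [/\ increasing_process A, integrable_process A & natural LIM A] &
      forall s, {ae P, forall w, X s w = condexp (F s) M w - A s w}].

End processes.

(* Main.v *)
From HB Require Import structures.
Require Import Defs.
From mathcomp Require Import all_boot all_order all_algebra finmap.
From mathcomp Require Import all_classical all_reals all_analysis.
From mathcomp.analysis.showcase Require summability.
From mathcomp Require Import measurable_realfun ess_sup_inf lra ring.
Import Order.TTheory GRing.Theory Num.Theory.
Import numFieldNormedType.Exports.

Set Implicit Arguments.
Unset Strict Implicit.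
Unset Printing Implicit Defensive.

(** For a step $p = ]s, t]$ of a grid $d$ let $D_p = X_s - P(X_t|F_s)$, which is
    nonnegative because $X$ is a supermartingale, and let $C^d_t$ be the sum of
    the $D_p$ over the steps of $d$ that end at or before $t$; this is the
    increasing process of the Doob decomposition of $X$ along $d$.  Conditional
    expectation is self-adjoint, so that for bounded $b$
      $- P \int P^d(b) dX = P(b C^d_\infty)$,
    and therefore $x_F(S) = LIM_d P(1_S C^d_\infty)$ ([corresponds_restrF]).

    If $X_t = P(M|F_t) - A_t$, the martingale part has no drift, and the same
    computation shows that an increasing process $A$ is natural if and only if
      $P(b (A_t - A_s)) = LIM_d P(b (C^d_t - C^d_s))$
    for all bounded $b$ and $s \le t$ ([natural_compensator_limit],
    [compensator_limit_natural]).  A natural increasing process is thus the weak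
    $L^1$ limit of the discrete compensators of $X$, which gives the theorem.

    - Uniqueness.  The right-hand side only involves $X$, so two decompositions
      have the same increments $A_t - A_s$; as the means of $A_s$ and $A'_s$ are
      arbitrarily small, $A = A'$ ([doob_meyer_unique]).
    - If the decomposition exists, $x_F(S)$ differs from $P(1_S (A_t - A_s))$ by
      at most the mean of $A$ gained outside $]s, t]$, which is small when $s$ is
      small and $t$ large; and $A_t - A_s$ is integrable
      ([doob_meyer_abs_continuous]).
    - Conversely, if $x_F$ is absolutely continuous, so are the smaller set
      functions $S \mapsto LIM_d P(1_S C^d_t)$.  They are then countably additive
      and have densities $A_t$, as $x_F$ has a density $M$
      ([weak_limit_density]).  The variable $C^d_t$ is $F_t$-measurable, hence so
      is $A_t$; the inequalities between the $C^d_t$ make $A$ increasing; and for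
      $S$ in $F_t$ the drifts after $t$ telescope, so that
      $P(1_S (M - A_t)) = LIM_d P(1_S (C^d_\infty - C^d_t)) = P(1_S X_t)$, because
      the potential $X$ vanishes at the end of the grid
      ([potential_tail_limit], [doob_meyer_exists]). *)

Local Open Scope classical_set_scope.
Local Open Scope ring_scope.

Local Notation ocitv := Defs.ocitv.

(** * Real-valued expectations *)

Section mean_theory.
Context {R : realType} {dT : measure_display} {T : measurableType dT}.
Variable P : probability T R.
Implicit Types (Y Z b : T -> R) (A B : set T) (C : R).

Local Notation E := (mean P).
Local Notation L1 := (Lfun P 1%:E).

Lemma L1P Y : Y \in L1 <-> P.-integrable setT (EFin \o Y).
Proof. exact: Lfun1_integrable. Qed.

Lemma L1_measurable Y : Y \in L1 -> measurable_fun setT Y.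
Proof. by move=> /L1P /integrableP[/measurable_EFinP]. Qed.

Lemma meanE Y : E Y = (\int[P]_w Y w)%R.
Proof. by rewrite /mean unlock. Qed.

Lemma expectation_mean Y : Y \in L1 -> 'E_P[Y]%E = (E Y)%:E.
Proof. by move=> Y1; rewrite /mean fineK// expectation_fin_num. Qed.

Lemma L1D Y Z : Y \in L1 -> Z \in L1 -> (fun w => Y w + Z w) \in L1.
Proof. by move=> /L1P Y1 /L1P Z1; apply/L1P; exact: (integrableD measurableT Y1 Z1). Qed.

Lemma L1N Y : Y \in L1 -> (fun w => - Y w) \in L1.
Proof. by move=> /L1P Y1; apply/L1P; exact: (integrableN Y1). Qed.

Lemma L1B Y Z : Y \in L1 -> Z \in L1 -> (fun w => Y w - Z w) \in L1.
Proof. by move=> Y1 Z1; apply: L1D => //; exact: L1N. Qed.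

Lemma L1Z c Y : Y \in L1 -> (fun w => c * Y w) \in L1.
Proof.
by move=> /L1P Y1; apply/L1P; exact: (integrableZl measurableT c Y1).
Qed.

Lemma L1_0 : (fun=> 0) \in L1.
Proof. by have := Lfun_cst P 0 1. Qed.

Lemma L1_sum I (s : seq I) (p : pred I) (Y : I -> T -> R) :
  (forall i, p i -> Y i \in L1) -> (fun w => \sum_(i <- s | p i) Y i w) \in L1.
Proof.
move=> Y1; elim: s => [|i s IH].
  by rewrite (_ : (fun _ => _) = fun=> 0) ?L1_0//; apply/funext => w; rewrite big_nil.
case: (boolP (p i)) => pi.
  rewrite (_ : (fun _ => _) = fun w => Y i w + \sum_(i <- s | p i) Y i w).
    by apply: L1D => //; exact: Y1.
  by apply/funext => w; rewrite big_cons pi.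
rewrite (_ : (fun _ => _) = fun w => \sum_(i <- s | p i) Y i w)//.
by apply/funext => w; rewrite big_cons (negbTE pi).
Qed.

Lemma L1_abs Y : Y \in L1 -> (fun w => `|Y w|) \in L1.
Proof. exact: Lfun_norm. Qed.

Lemma meanD Y Z : Y \in L1 -> Z \in L1 ->
  E (fun w => Y w + Z w) = E Y + E Z.
Proof. by move=> /L1P Y1 /L1P Z1; rewrite !meanE RintegralD. Qed.

Lemma meanB Y Z : Y \in L1 -> Z \in L1 ->
  E (fun w => Y w - Z w) = E Y - E Z.
Proof. by move=> /L1P Y1 /L1P Z1; rewrite !meanE RintegralB. Qed.

Lemma meanZ c Y : Y \in L1 -> E (fun w => c * Y w) = c * E Y.
Proof. by move=> /L1P Y1; rewrite !meanE RintegralZl. Qed.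

Lemma mean0 : E (fun=> 0) = 0.
Proof. by rewrite /mean (expectation_cst P 0). Qed.

Lemma mean_sum I (s : seq I) (p : pred I) (Y : I -> T -> R) :
  (forall i, p i -> Y i \in L1) ->
  E (fun w => \sum_(i <- s | p i) Y i w) = \sum_(i <- s | p i) E (Y i).
Proof.
move=> Y1; elim: s => [|i s IH].
  by rewrite big_nil -[RHS]mean0; congr (mean P _); apply/funext => w; rewrite big_nil.
rewrite big_cons; case: (boolP (p i)) => pi.
  rewrite -IH -meanD//; [|exact: Y1|exact: L1_sum].
  by congr (mean P _); apply/funext => w; rewrite big_cons pi.
rewrite -IH.
by congr (mean P _); apply/funext => w; rewrite big_cons (negbTE pi).
Qed.

Lemma mean_ae_eq Y Z : measurable_fun setT Y -> measurable_fun setT Z ->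
  {ae P, forall w, Y w = Z w} -> E Y = E Z.
Proof.
move=> mY mZ YZ; rewrite !meanE /Rintegral; congr fine.
apply: ae_eq_integral => //; [exact/measurable_EFinP|exact/measurable_EFinP|].
by apply: filterS YZ => w /= ->.
Qed.

Lemma mean_ge0 Y : measurable_fun setT Y ->
  {ae P, forall w, 0 <= Y w} -> 0 <= E Y.
Proof.
move=> mY Y0.
have -> : E Y = E (fun w => Num.max 0 (Y w)).
  apply: mean_ae_eq => //; first exact: measurable_maxr.
  by apply: filterS Y0 => w /= Y0; rewrite max_r.
by rewrite meanE; apply: Rintegral_ge0 => w _; rewrite le_max lexx.
Qed.

Lemma le_mean Y Z : Y \in L1 -> Z \in L1 ->
  {ae P, forall w, Y w <= Z w} -> E Y <= E Z.
Proof.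
move=> Y1 Z1 YZ; rewrite -subr_ge0 -meanB//; apply: mean_ge0.
  by apply: L1_measurable; exact: L1B.
by apply: filterS YZ => w /=; rewrite subr_ge0.
Qed.

Lemma mean_norm_ge0 Y : Y \in L1 -> {ae P, forall w, 0 <= Y w} ->
  E (fun w => `|Y w|) = E Y.
Proof.
move=> Y1 Y0; apply: mean_ae_eq; [|exact: L1_measurable|].
  by apply: L1_measurable; exact: L1_abs.
by apply: filterS Y0 => w /= ?; rewrite ger0_norm.
Qed.

Lemma normr_mean Y : Y \in L1 -> `|E Y| <= E (fun w => `|Y w|).
Proof. by move=> /L1P Y1; rewrite !meanE le_normr_Rintegral. Qed.

Lemma L1_dominated Y Z : measurable_fun setT Y -> Z \in L1 ->
  {ae P, forall w, `|Y w| <= Z w} -> Y \in L1.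
Proof.
move=> mY Z1 YZ; apply/L1P; apply/integrableP; split; first exact/measurable_EFinP.
have /L1P /integrableP[mZ] := Z1; apply: le_lt_trans.
apply: ae_ge0_le_integral => //.
- by apply: measurableT_comp => //; exact/measurable_EFinP.
- by apply: measurableT_comp.
apply: filterS YZ => w /= YZ _.
by rewrite lee_fin (le_trans YZ)// ler_norm.
Qed.

Lemma mean_eq0 Y : Y \in L1 -> {ae P, forall w, 0 <= Y w} -> E Y = 0 ->
  {ae P, forall w, Y w = 0}.
Proof.
move=> Y1 Y0 EY.
have mY := L1_measurable Y1.
have : (\int[P]_w `|(Y w)%:E| = 0)%E.
  have -> : (\int[P]_w `|(Y w)%:E| = 'E_P[fun w => `|Y w|%R])%E by rewrite unlock.
  by rewrite expectation_mean ?L1_abs// mean_norm_ge0// EY.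
move=> /ae_eq_integral_abs; move=> /(_ measurableT).
rewrite -/(EFin \o Y) => H.
have /H : measurable_fun setT (EFin \o Y) by exact/measurable_EFinP.
by apply: filterS => w /= /(_ I) [].
Qed.

(** The bound is kept as a parameter, and only almost sure, because versions of
    conditional expectations of bounded variables satisfy no better one. *)
Definition ebounded C b :=
  measurable_fun setT b /\ {ae P, forall w, `|b w| <= C}.

Lemma ebounded_norm C b : ebounded C b -> ebounded `|C| b.
Proof.
move=> [mb babs]; split => //.
by apply: filterS babs => w /le_trans; apply; exact: ler_norm.
Qed.

Lemma eboundedM C C' b b' : ebounded C b -> ebounded C' b' ->
  ebounded (C * C') (fun w => b w * b' w).
Proof.
move=> [mb bC] [mb' bC']; split; first exact: measurable_funM.
by apply: filterS2 bC bC' => w /= ? ?; rewrite normrM ler_pM.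
Qed.

Lemma eboundedMl C b Y : ebounded C b -> Y \in L1 -> (fun w => b w * Y w) \in L1.
Proof.
move=> [mb bC] Y1; apply: (@L1_dominated _ (fun w => C * `|Y w|)).
- by apply: measurable_funM => //; exact: L1_measurable.
- by apply: L1Z; exact: L1_abs.
- by apply: filterS bC => w /= bC; rewrite normrM ler_wpM2r.
Qed.

Lemma ebounded_L1 C b : ebounded C b -> b \in L1.
Proof.
move=> [mb bC]; apply: (@L1_dominated _ (fun=> C)) => //.
exact: Lfun_cst.
Qed.

Lemma mean_ebounded C b Y : ebounded C b -> Y \in L1 ->
  `|E (fun w => b w * Y w)| <= C * E (fun w => `|Y w|).
Proof.
move=> bC Y1; apply: le_trans (normr_mean _) _; first exact: eboundedMl bC Y1.
rewrite -meanZ; last exact: L1_abs.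
apply: le_mean; first by apply: L1_abs; exact: eboundedMl bC Y1.
  by apply: L1Z; exact: L1_abs.
by case: bC => _; apply: filterS => w bC; rewrite normrM ler_wpM2r.
Qed.

Lemma ebounded_indic A : measurable A -> ebounded 1 (\1_A).
Proof.
move=> mA; split; first exact: measurable_indic.
by apply/nearW => w; rewrite indicE ger0_norm// lern1 leq_b1.
Qed.

Lemma LinftyP b : b \in Lfun P +oo%E <-> exists C, ebounded C b.
Proof.
have P0 : (0 < P setT)%E by rewrite probability_setT.
have nE : (abse \o (EFin \o b)) = (EFin \o (Num.norm \o b)) by apply/funext.
split=> [/andP[]|[C [mb bC]]].
  rewrite !inE /= /finite_norm unlock P0 nE => mb /ess_supr_bounded[C bC].
  by exists C; split => //.
apply/andP; split; rewrite inE //= /finite_norm unlock P0 nE.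
apply: (@le_lt_trans _ _ C%:E); last exact: ltry.
by apply/ess_supP; apply: filterS bC => w /=; rewrite lee_fin.
Qed.

End mean_theory.

(** * Functions measurable with respect to a sub-sigma-algebra *)

Lemma sigma_algebra_setT {U : Type} (G : set (set U)) :
  sigma_algebra setT G -> G setT.
Proof. by move=> [G0 GC _]; rewrite -(setD0 setT); exact: GC. Qed.

Section measurable_wrt_theory.
Context {R : realType} {dT : measure_display} {T : measurableType dT}.
Variables (G : set (set T)) (GT : sigma_algebra setT G).
Implicit Types (f g : T -> R).

Lemma measurable_wrtP f :
  measurable_wrt G f <->
  measurable_fun setT (f : g_sigma_algebraType G -> R).
Proof.
have GE := measurable_g_measurableTypeE GT.
split=> [Gf _ B mB|mf B mB].
  by rewrite setTI GE; exact: Gf.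
by rewrite -GE -[X in _ X]setTI; exact: mf.
Qed.

Lemma measurable_wrt_comp (h : R -> R) f :
  measurable_fun setT h -> measurable_wrt G f -> measurable_wrt G (h \o f).
Proof.
move=> mh Gf B mB; rewrite comp_preimage; apply: Gf.
by rewrite -[X in measurable X]setTI; exact: mh.
Qed.

Lemma measurable_wrtM f g : measurable_wrt G f -> measurable_wrt G g ->
  measurable_wrt G (fun w => f w * g w).
Proof.
by move=> /measurable_wrtP Gf /measurable_wrtP Gg; apply/measurable_wrtP/measurable_funM.
Qed.

Lemma measurable_wrtB f g : measurable_wrt G f -> measurable_wrt G g ->
  measurable_wrt G (fun w => f w - g w).
Proof.
by move=> /measurable_wrtP Gf /measurable_wrtP Gg; apply/measurable_wrtP/measurable_funB.
Qed.

Lemma measurable_wrt_lin a c f g : measurable_wrt G f -> measurable_wrt G g ->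
  measurable_wrt G (fun w => a * f w + c * g w).
Proof.
move=> /measurable_wrtP Gf /measurable_wrtP Gg; apply/measurable_wrtP.
by apply: measurable_funD; apply: measurable_funM.
Qed.

Lemma measurable_wrt_sum I (s : seq I) (p : pred I) (f : I -> T -> R) :
  (forall i, p i -> measurable_wrt G (f i)) ->
  measurable_wrt G (fun w => \sum_(i <- s | p i) f i w).
Proof.
move=> Gf; apply/measurable_wrtP.
rewrite (_ : (fun _ => _) = fun w => \sum_(i <- s) (if p i then f i w else 0)).
  apply: measurable_sum => i; case: (boolP (p i)) => [/Gf/measurable_wrtP//|_].
  exact: measurable_cst.
by apply/funext => w; rewrite -big_mkcond.
Qed.

Lemma measurable_wrt_indic B : G B -> measurable_wrt G (\1_B : T -> R).
Proof.
move=> GB; apply/measurable_wrtP; apply: measurable_indic.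
by rewrite measurable_g_measurableTypeE.
Qed.

Lemma measurable_wrt_cst (c : R) : measurable_wrt G (fun=> c).
Proof. by apply/measurable_wrtP; exact: measurable_cst. Qed.

Lemma measurable_wrt_measurable f : G `<=` measurable ->
  measurable_wrt G f -> measurable_fun setT f.
Proof. by move=> Gm Gf _ B mB; rewrite setTI; apply: Gm; exact: Gf. Qed.

(** A function $b$ with values in $[0,1]$ is the average
    $b = (1_{b \ge 1/2} + b')/2$ of an indicator function and of another function
    $b'$ with values in $[0,1]$.  Hence a functional that vanishes on indicator
    functions satisfies $L(b) = L(b')/2$, and iterating, $|L(b)| \le K 2^{-n}$
    for all $n$. *)
Lemma indicators_determine (L : (T -> R) -> R) (K : R) :
  (forall a c b b' C, measurable_wrt G b -> measurable_wrt G b' ->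
    (forall w, `|b w| <= C) -> (forall w, `|b' w| <= C) ->
    L (fun w => a * b w + c * b' w) = a * L b + c * L b') ->
  (forall b, measurable_wrt G b -> (forall w, 0 <= b w <= 1) -> `|L b| <= K) ->
  (forall B, G B -> L (\1_B) = 0) ->
  forall b C, measurable_wrt G b -> (forall w, `|b w| <= C) -> L b = 0.
Proof.
move=> Llin LK L0.
have abs1 (b : T -> R) : (forall w, 0 <= b w <= 1) -> forall w, `|b w| <= 1.
  by move=> b01 w; have /andP[b0 b1] := b01 w; rewrite ger0_norm.
have indic01 B w : 0 <= (\1_B : T -> R) w <= 1.
  by rewrite indicE; case: (w \in B); rewrite /= ?lexx ?ler01.
have halve n : forall b, measurable_wrt G b -> (forall w, 0 <= b w <= 1) ->
    `|L b| <= K / 2 ^+ n.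
  elim: n => [|n IH] b Gb b01; first by rewrite expr0 divr1 LK.
  pose B := b @^-1` [set` `[2^-1, +oo[].
  have GB : G B by apply: Gb; exact: measurable_itv.
  pose b' w := 2 * b w + (-1) * \1_B w.
  have Gb' : measurable_wrt G b'.
    by apply: measurable_wrt_lin => //; exact: measurable_wrt_indic.
  have b'01 w : 0 <= b' w <= 1.
    have := b01 w; rewrite /b' indicE.
    have -> : (w \in B) = (2^-1 <= b w).
      by apply/idP/idP; rewrite inE /B /= in_itv /= andbT.
    by case: (leP 2^-1 (b w)) => ? /=; rewrite /= ?mulr1 ?mulr0; lra.
  have -> : b = fun w => 2^-1 * \1_B w + 2^-1 * b' w.
    by apply/funext => w; rewrite /b'; field.
  rewrite (Llin _ _ _ _ 1)//; last 3 first.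
  - exact: measurable_wrt_indic.
  - exact/abs1/indic01.
  - exact: abs1.
  rewrite L0// mulr0 add0r normrM exprS invfM mulrCA gtr0_norm//.
  by rewrite ler_pM2l// IH.
have L01 b : measurable_wrt G b -> (forall w, 0 <= b w <= 1) -> L b = 0.
  move=> Gb b01; apply/eqP; rewrite -normr_le0; apply/ler_addgt0Pl => e e0.
  rewrite addr0.
  have [K0|K0] := leP K 0.
    by rewrite (le_trans (LK _ Gb b01))// (le_trans K0)// ltW.
  have : (fun n => K * 2^-1 ^+ n) @ \oo --> K * (0 : R).
    by apply: cvgMr; apply: cvg_expr; rewrite gtr0_norm// invf_lt1// ltr1n.
  rewrite mulr0 => /cvgrPdist_le /(_ _ e0) [n _ /(_ n (leqnn n))] /=.
  rewrite sub0r normrN => Ke.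
  rewrite (le_trans (halve n _ Gb b01))// (le_trans _ Ke)//.
  by rewrite exprVn ler_norm.
move=> b C Gb bC.
pose D := `|C| + 1.
have D0 : 0 < D by rewrite /D ltr_wpDl.
have bD w : - D <= b w <= D.
  by rewrite -ler_norml (le_trans (bC w))// /D ler_wpDr// ler_norm.
pose b' w := (2 * D)^-1 * b w + 2^-1 * \1_setT w.
have Gb' : measurable_wrt G b'.
  apply: measurable_wrt_lin => //; apply: measurable_wrt_indic.
  exact: sigma_algebra_setT GT.
have b'01 w : 0 <= b' w <= 1.
  have /andP[Db bD'] := bD w; rewrite /b' indicT mulr1.
  have -> : (2 * D)^-1 * b w + 2^-1 = (b w + D) / (2 * D).
    by field; rewrite gt_eqF.
  rewrite divr_ge0 ?ler_pdivrMr ?mulr_gt0//=; last 2 first.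
  - by rewrite -lerBlDr sub0r.
  - by rewrite mulr_ge0// ltW.
  by rewrite mul1r mulr_natl mulr2n lerD2r.
have -> : b = fun w => (2 * D) * b' w + (- D) * \1_setT w.
  by apply/funext => w; rewrite /b' indicT; field; rewrite gt_eqF.
have GT' := sigma_algebra_setT GT.
rewrite (Llin _ _ _ _ 1)//; last 3 first.
- exact: measurable_wrt_indic.
- exact: abs1.
- exact/abs1/indic01.
by rewrite L0// L01// !mulr0 addr0.
Qed.

End measurable_wrt_theory.

(** * Conditional expectation *)

Section condexp_theory.
Context {R : realType} {dT : measure_display} {T : measurableType dT}.
Variable P : probability T R.
Variables (G : set (set T)) (GT : sigma_algebra setT G) (Gm : G `<=` measurable).
Implicit Types (Y Z W b f g : T -> R) (A B : set T) (C : R).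

Local Notation E := (mean P).
Local Notation L1 := (Lfun P 1%:E).

Lemma ebounded_le C b : measurable_fun setT b -> (forall w, `|b w| <= C) ->
  ebounded P C b.
Proof. by move=> mb bC; split => //; apply/nearW. Qed.

Lemma mean_dominated_cvg (Y_ : nat -> T -> R) Y Z :
  (forall n, measurable_fun setT (Y_ n)) -> Z \in L1 ->
  (forall n w, `|Y_ n w| <= Z w) -> (forall w, Y_ ^~ w @ \oo --> Y w) ->
  E (Y_ n) @[n --> \oo] --> E Y.
Proof.
move=> mY_ Z1 YZ Ycvg.
have mY : measurable_fun setT Y by apply: measurable_fun_cvg mY_ _ => w _.
have Y1 : Y \in L1.
  apply: (L1_dominated mY Z1); apply/nearW => w.
  have Yn : `|Y_ n w| @[n --> \oo] --> `|Y w| by apply: cvg_norm; exact: Ycvg.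
  rewrite -(cvg_lim _ Yn)//; apply: limr_le; first by apply/cvg_ex; eexists; exact: Yn.
  by apply/nearW => n; exact: YZ.
have Yn1 n : Y_ n \in L1.
  by apply: (L1_dominated (mY_ n) Z1); apply/nearW => w; exact: YZ.
apply: fine_cvg; rewrite fineK ?expectation_fin_num// unlock.
apply: (@dominated_cvg _ _ _ P setT measurableT _ _ (EFin \o Z)) => //.
- by move=> n; apply/measurable_EFinP; exact: mY_.
- by move=> w _; apply: cvg_EFin; [exact/nearW|exact: Ycvg].
- exact/L1P.
- by move=> n w _; rewrite lee_fin.
Qed.

(** For bounded [g] this is [indicators_determine].  In general [g] is
    approximated by its truncations, which are dominated by [g] itself, so that
    integrability of the product is all that is required. *)
Lemma mean_orthogonal W g :
  W \in L1 -> (forall B, G B -> E (fun w => \1_B w * W w) = 0) ->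
  measurable_wrt G g -> (fun w => g w * W w) \in L1 ->
  E (fun w => g w * W w) = 0.
Proof.
move=> W1 W0 Gg gW1.
have bd b C : measurable_wrt G b -> (forall w, `|b w| <= C) -> ebounded P C b.
  by move=> Gb bC; apply: ebounded_le => //; exact: measurable_wrt_measurable Gb.
have bounded_case b C : measurable_wrt G b -> (forall w, `|b w| <= C) ->
    E (fun w => b w * W w) = 0.
  apply: (indicators_determine (L := fun b => E (fun w => b w * W w)) GT
            (K := E (fun w => `|W w|))) => //.
  - move=> a c b0 b1 C0 Gb0 Gb1 b0C b1C.
    have b01 := eboundedMl (bd _ _ Gb0 b0C) W1.
    have b11 := eboundedMl (bd _ _ Gb1 b1C) W1.
    rewrite -(meanZ a)// -(meanZ c)// -meanD; [|exact: L1Z..].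
    by congr (mean P _); apply/funext => w; ring.
  - move=> b0 Gb0 b01.
    rewrite -[leRHS]mul1r; apply: mean_ebounded => //; apply: bd => // w.
    by have /andP[b00 b0C] := b01 w; rewrite ger0_norm.
pose h (n : nat) (r : R) : R := if `|r| <= n%:R then r else 0.
have mh n : measurable_fun setT (h n).
  apply: measurable_fun_ifT => //; exact: measurable_fun_ler.
have hle n r : `|h n r| <= `|r| by rewrite /h; case: ifP; rewrite ?normr0.
have hn n r : `|h n r| <= n%:R by rewrite /h; case: ifP; rewrite ?normr0.
have Ghg n : measurable_wrt G (h n \o g) by apply: measurable_wrt_comp.
have mg := measurable_wrt_measurable Gm Gg.
have : E (fun w => h n (g w) * W w) @[n --> \oo] --> E (fun w => g w * W w).
  apply: (mean_dominated_cvg (Z := fun w => `|g w * W w|)).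
  - move=> n; apply: measurable_funM; last exact: L1_measurable W1.
    exact: measurable_wrt_measurable (Ghg n).
  - exact: L1_abs.
  - by move=> n w; rewrite !normrM ler_wpM2r.
  - move=> w; apply: cvgMl; apply: cvg_near_cst.
    by near=> n; rewrite /h ifT//; near: n; exact: nbhs_infty_ger.
have -> : (fun n => E (fun w => h n (g w) * W w)) = fun=> 0.
  by apply/funext => n; exact: (bounded_case (h n \o g) n%:R (Ghg n) (fun w => hn n (g w))).
by move=> /cvg_lim <-//; rewrite lim_cst.
Unshelve. all: by end_near. Qed.

(** Testing on the set where a [G]-measurable function is negative. *)
Lemma ae_ge0_of_mean Y : measurable_wrt G Y -> Y \in L1 ->
  (forall B, G B -> 0 <= E (fun w => \1_B w * Y w)) ->
  {ae P, forall w, 0 <= Y w}.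
Proof.
move=> GY Y1 Y0.
pose B := Y @^-1` [set` `]-oo, 0[].
have GB : G B by apply: GY; exact: measurable_itv.
have YB w : \1_B w * - Y w = Num.max 0 (- Y w).
  rewrite indicE; have -> : (w \in B) = (Y w < 0).
    by apply/idP/idP; rewrite inE /B /= in_itv.
  by case: (ltP (Y w) 0) => Yw; rewrite /= ?mul1r ?mul0r;
    [rewrite max_r// oppr_ge0 ltW|rewrite max_l// oppr_le0].
have B1 : (fun w => \1_B w * Y w) \in L1.
  by apply: eboundedMl (ebounded_indic _ (Gm GB)) Y1.
have : {ae P, forall w, Num.max 0 (- Y w) = 0}.
  apply: mean_eq0.
  - under eq_fun do rewrite -YB mulrN; exact: L1N.
  - by apply/nearW => w; rewrite le_max lexx.
  - apply/eqP; rewrite eq_le mean_ge0 ?andbT; last 2 first.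
    + apply: measurable_maxr => //; apply: measurable_funN; exact: (L1_measurable Y1).
    + by apply/nearW => w; rewrite le_max lexx.
    under eq_fun do rewrite -YB mulrN -mulN1r.
    by rewrite meanZ// mulN1r oppr_le0 Y0.
by apply: filterS => w /eqP; rewrite eq_maxl oppr_le0.
Qed.

Lemma ae_le_of_mean Y Z : measurable_wrt G Y -> measurable_wrt G Z ->
  Y \in L1 -> Z \in L1 ->
  (forall B, G B -> E (fun w => \1_B w * Y w) <= E (fun w => \1_B w * Z w)) ->
  {ae P, forall w, Y w <= Z w}.
Proof.
move=> GY GZ Y1 Z1 YZ.
have : {ae P, forall w, 0 <= Z w - Y w}.
  apply: ae_ge0_of_mean; [exact: measurable_wrtB|exact: L1B|move=> B GB].
  under eq_fun do rewrite mulrBr.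
  have eB := ebounded_indic P (Gm GB).
  by rewrite meanB ?subr_ge0 ?YZ//; exact: eboundedMl eB _.
by apply: filterS => w; rewrite subr_ge0.
Qed.

Lemma ae_eq_of_mean Y Z : measurable_wrt G Y -> measurable_wrt G Z ->
  Y \in L1 -> Z \in L1 ->
  (forall B, G B -> E (fun w => \1_B w * Y w) = E (fun w => \1_B w * Z w)) ->
  {ae P, forall w, Y w = Z w}.
Proof.
move=> GY GZ Y1 Z1 YZ.
have YleZ : {ae P, forall w, Y w <= Z w} by apply: ae_le_of_mean => // B /YZ ->.
have ZleY : {ae P, forall w, Z w <= Y w} by apply: ae_le_of_mean => // B /YZ ->.
by apply: filterS2 YleZ ZleY => w ? ?; apply/eqP; rewrite eq_le; apply/andP.
Qed.

Lemma integral_mean B Y : G B -> Y \in L1 ->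
  (\int[P]_(w in B) (Y w)%:E = (E (fun w => \1_B w * Y w))%:E)%E.
Proof.
move=> GB Y1.
rewrite -expectation_mean; last exact: eboundedMl (ebounded_indic _ (Gm GB)) Y1.
rewrite unlock integral_mkcond; apply: eq_integral => w _.
by rewrite patchE indicE; case: ifP => _; rewrite ?mul1r ?mul0r.
Qed.

Let GTy : measurableType G.-sigma := g_sigma_algebraType G.

Let measurable_idG : measurable_fun setT (id : T -> GTy).
Proof.
move=> _ B; rewrite (measurable_g_measurableTypeE GT) setTI; exact: Gm.
Qed.

(** Radon-Nikodym on the sub-sigma-algebra: [G] is made into a measurable type,
    which carries the law of the identity map under [P] and the restriction to
    [G] of the measure with density [Y]. *)
Lemma is_condexp_ex Y : Y \in L1 -> exists Z, is_condexp P G Y Z.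
Proof.
move=> Y1; have /L1P Yint := Y1.
pose idG : {mfun T >-> GTy} := HB.pack (id : T -> GTy) 
   (isMeasurableFun.Build _ _ _ _ _ measurable_idG).
pose PG := distribution P idG.
pose nuY (B : set GTy) := (\int[P]_(w in B) (Y w)%:E)%E.
have mG (B : set GTy) : measurable B -> measurable (B : set T).
  by rewrite (measurable_g_measurableTypeE GT); exact: Gm.
have nuY0 : nuY set0 = 0%E by rewrite /nuY integral_set0.
have nuY_fin (B : set GTy) : measurable B -> nuY B \is a fin_num.
  move=> mB; apply: integrable_fin_num; first exact: mG.
  by apply: integrableS Yint => //; exact: mG.
have nuY_sigma : @semi_sigma_additive _ R GTy nuY.
  move=> B mB tB mUB.
  apply: (charge_semi_sigma_additive (s := induced_charge Yint)) => //.
  - by move=> n; exact: mG (mB n).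
  - exact: mG.
pose nu : {charge set GTy -> \bar R} :=
  HB.pack nuY (isCharge.Build _ _ _ nuY nuY0 nuY_fin nuY_sigma).
have nuP : nu `<< PG.
  apply/null_content_dominatesP => B mB PB0.
  apply: null_set_integral => //; first exact: mG.
  by apply: measurable_funTS; case/integrableP: Yint.
pose f := Radon_Nikodym nu PG.
have ffin w : f w \is a fin_num by exact: Radon_Nikodym_fin_num.
have fint : PG.-integrable setT f by exact: Radon_Nikodym_integrable.
have [mf foo] := integrableP _ _ _ fint.
have mf' : measurable_fun setT (f : T -> \bar R).
  by move=> _ B mB; apply: mG; exact: mf.
have fP : P.-integrable setT (f : T -> \bar R).
  apply/integrableP; split => //; move: foo.
  by rewrite ge0_integral_pushforward//; exact: measurableT_comp.
pose Z := fine \o f.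
have ZE : EFin \o Z = f by apply/funext => w; rewrite /Z /= fineK.
exists Z; split.
- apply/measurable_wrtP => //; exact: measurableT_comp.
- by apply/L1P; rewrite ZE.
- move=> B GB; have mB : measurable (B : set GTy).
    by rewrite (measurable_g_measurableTypeE GT).
  transitivity (nu B) => //.
  rewrite (Radon_Nikodym_integral nuP mB) integral_pushforward//.
  - by apply: eq_integral => w _; rewrite /Z /= fineK.
  - by apply: (integrableS measurableT _ _ fP) => //; exact: mG.
Qed.

Local Notation cond := (condexp P G).

Lemma condexpP Y : Y \in L1 -> is_condexp P G Y (cond Y).
Proof. by move=> /is_condexp_ex; exact: xgetPex. Qed.

Lemma condexp_measurable Y : Y \in L1 -> measurable_wrt G (cond Y).
Proof. by move=> /condexpP[]. Qed.

Lemma condexp_L1 Y : Y \in L1 -> cond Y \in L1.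
Proof. by move=> /condexpP[]. Qed.

Lemma condexp_measurable_fun Y : Y \in L1 -> measurable_fun setT (cond Y).
Proof. by move=> /condexp_L1/L1_measurable. Qed.

Lemma mean_condexp_set B Y : G B -> Y \in L1 ->
  E (fun w => \1_B w * cond Y w) = E (fun w => \1_B w * Y w).
Proof.
move=> GB Y1; have [_ c1 /(_ _ GB)] := condexpP Y1.
by rewrite !integral_mean// => -[].
Qed.

Lemma mean_mul_condexp g Y : Y \in L1 -> measurable_wrt G g ->
  (fun w => g w * Y w) \in L1 -> (fun w => g w * cond Y w) \in L1 ->
  E (fun w => g w * cond Y w) = E (fun w => g w * Y w).
Proof.
move=> Y1 Gg gY1 gc1; apply/eqP; rewrite -subr_eq0 -meanB//; apply/eqP.
under eq_fun do rewrite -mulrBr.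
apply: mean_orthogonal => //; first by apply: L1B => //; exact: condexp_L1.
  move=> B GB; have eB := ebounded_indic P (Gm GB).
  under eq_fun do rewrite mulrBr.
  rewrite meanB; [|exact: eboundedMl eB (condexp_L1 Y1)|exact: eboundedMl eB Y1].
  by rewrite mean_condexp_set// subrr.
by under eq_fun do rewrite mulrBr; exact: L1B.
Qed.

Lemma mean_condexp Y : Y \in L1 -> E (cond Y) = E Y.
Proof.
move=> Y1; have := mean_condexp_set (sigma_algebra_setT GT) Y1.
have e f : (fun w => \1_setT w * f w) = f.
  by apply/funext => w; rewrite indicT mul1r.
by rewrite !e.
Qed.

Lemma condexp_ae_eq Y Z : Y \in L1 -> Z \in L1 -> measurable_wrt G Z ->
  (forall B, G B -> E (fun w => \1_B w * Z w) = E (fun w => \1_B w * Y w)) ->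
  {ae P, forall w, cond Y w = Z w}.
Proof.
move=> Y1 Z1 GZ ZY; apply: ae_eq_of_mean => //.
- exact: condexp_measurable.
- exact: condexp_L1.
- by move=> B GB; rewrite ZY// mean_condexp_set.
Qed.

(** Both bounds are inequalities between [G]-measurable variables, and so can be
    tested on the sets of [G], where [cond b] may be replaced by [b]. *)
Lemma condexp_ebounded C b : ebounded P C b -> ebounded P C (cond b).
Proof.
move=> bC; have b1 := ebounded_L1 bC; have [mb babs] := bC.
split; first exact: condexp_measurable_fun.
have cst1 (c : R) : (fun=> c) \in L1 by exact: (Lfun_cst P c 1).
have cstG (c : R) : measurable_wrt G (fun=> c) by exact: measurable_wrt_cst.
have Gc := condexp_measurable b1; have c1 := condexp_L1 b1.
have up : {ae P, forall w, cond b w <= C}.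
  apply: ae_le_of_mean => // B GB; rewrite mean_condexp_set//.
  have eB := ebounded_indic P (Gm GB).
  apply: le_mean; [exact: eboundedMl eB _|exact: eboundedMl eB _|].
  apply: filterS babs => w bw; rewrite ler_wpM2l//.
  exact: le_trans (ler_norm _) bw.
have lo : {ae P, forall w, - C <= cond b w}.
  apply: ae_le_of_mean => // B GB; rewrite mean_condexp_set//.
  have eB := ebounded_indic P (Gm GB).
  apply: le_mean; [exact: eboundedMl eB _|exact: eboundedMl eB _|].
  apply: filterS babs => w bw; rewrite ler_wpM2l//.
  by move: bw; rewrite ler_norml => /andP[].
by apply: filterS2 up lo => w ? ?; rewrite ler_norml; apply/andP.
Qed.

(** Self-adjointness of the conditional expectation, in the form in which it is
    met in a stochastic integral of a projected integrand: [f] is the known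
    part of the integrand, [Y] and [Z] are the values of the integrator at
    the two ends of a step, and [cond Z - Y] is its drift there. *)
Lemma mean_condexp_increment C b D f Y Z :
  ebounded P C b -> ebounded P D f -> measurable_wrt G f ->
  Y \in L1 -> measurable_wrt G Y -> Z \in L1 ->
  E (fun w => cond b w * f w * (Z w - Y w)) =
  E (fun w => b w * f w * (cond Z w - Y w)).
Proof.
move=> bC fD Gf Y1 GY Z1.
have b1 := ebounded_L1 bC; have cbC := condexp_ebounded bC.
have Gcb := condexp_measurable b1.
have cbf := eboundedM cbC fD; have bf := eboundedM bC fD.
have cZ1 := condexp_L1 Z1.
(* First [Z] is projected, against the [G]-measurable [cond b * f]; then the
   projection of [b] is undone, against the [G]-measurable [f * (cond Z - Y)]. *)
transitivity (E (fun w => cond b w * f w * (cond Z w - Y w))).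
  under eq_fun do rewrite mulrBr.
  under [in RHS]eq_fun do rewrite mulrBr.
  rewrite !meanB; try exact: eboundedMl cbf _.
  rewrite (@mean_mul_condexp (fun w => cond b w * f w))//.
  - exact: measurable_wrtM.
  - exact: eboundedMl cbf _.
  - exact: eboundedMl cbf _.
have D1 : (fun w => cond Z w - Y w) \in L1 by exact: L1B.
pose g w := f w * (cond Z w - Y w).
have gE c : (fun w => c w * f w * (cond Z w - Y w)) = fun w => g w * c w.
  by apply/funext => w; rewrite /g; ring.
have g1 c c' : ebounded P c' c -> (fun w => g w * c w) \in L1.
  by move=> cc'; rewrite -gE; exact: eboundedMl (eboundedM cc' fD) D1.
rewrite !gE mean_mul_condexp//; try exact: g1 bC; try exact: g1 cbC.
apply: measurable_wrtM => //; apply: measurable_wrtB => //.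
exact: condexp_measurable.
Qed.

End condexp_theory.

(** * Banach limits and weak limits in L1 *)

#[local] Existing Instance summability.totally_filter.

Section banach_limit_theory.
Context {R : realType} {disp : Order.disp_t} {Delta : orderType disp}.
Variable LIM : ({fset Delta} -> R) -> R.
Hypothesis LIMP : banach_limit LIM.
Implicit Types (u v : {fset Delta} -> R) (d : {fset Delta}).

Definition bounded_net u := exists C, forall d, `|u d| <= C.

Lemma bounded_net_fun u : bounded_net u -> bounded_fun u.
Proof.
move=> [C uC]; exists C; split; first exact: num_real.
by move=> x Cx d _; exact: le_trans (uC d) (ltW Cx).
Qed.

Lemma bounded_net_lin a c u v : bounded_net u -> bounded_net v ->
  bounded_net (fun d => a * u d + c * v d).
Proof.
move=> [C uC] [D vD]; exists (`|a| * C + `|c| * D) => d.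
by rewrite (le_trans (ler_normD _ _))// lerD// normrM ler_wpM2l.
Qed.

Lemma bounded_net_cst c : bounded_net (fun=> c).
Proof. by exists `|c|. Qed.

Lemma LIM_cst c : LIM (fun=> c) = c.
Proof.
apply: banach_limit_cvg => //; first exact/bounded_net_fun/bounded_net_cst.
exact: cvg_cst.
Qed.

Lemma LIM_lin a c u v : bounded_net u -> bounded_net v ->
  LIM (fun d => a * u d + c * v d) = a * LIM u + c * LIM v.
Proof.
move=> bu bv; rewrite (@banach_limit_linear _ _ _ _ LIMP)//; last 2 first.
- exact: bounded_net_fun.
- have := bounded_net_lin 0 c bv bv.
  by under eq_fun do rewrite mul0r add0r; exact: bounded_net_fun.
congr (_ + _).
rewrite -[RHS]addr0 -[X in _ + X](LIM_cst 0).
rewrite -(@banach_limit_linear _ _ _ _ LIMP)//.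
- by congr LIM; apply/funext => d; rewrite addr0.
- exact: bounded_net_fun.
- exact/bounded_net_fun/bounded_net_cst.
Qed.

Lemma LIM_sub u v : bounded_net u -> bounded_net v ->
  LIM (fun d => u d - v d) = LIM u - LIM v.
Proof.
move=> bu bv; rewrite -mulN1r -[LIM u]mul1r -LIM_lin//.
by congr LIM; apply/funext => d; rewrite mul1r mulN1r.
Qed.

Lemma LIM_add u v : bounded_net u -> bounded_net v ->
  LIM (fun d => u d + v d) = LIM u + LIM v.
Proof.
move=> bu bv; rewrite -[LIM v]mul1r -[LIM u]mul1r -LIM_lin//.
by congr LIM; apply/funext => d; rewrite !mul1r.
Qed.

Lemma LIM_scale a u : bounded_net u -> LIM (fun d => a * u d) = a * LIM u.
Proof.
move=> bu; rewrite -[RHS]addr0 -[X in _ + X](mul0r (LIM u)) -LIM_lin//.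
by congr LIM; apply/funext => d; rewrite mul0r addr0.
Qed.

Lemma LIM_sum (I : eqType) (s : seq I) (u : I -> {fset Delta} -> R) :
  (forall i, i \in s -> bounded_net (u i)) ->
  bounded_net (fun d => \sum_(i <- s) u i d) /\
  LIM (fun d => \sum_(i <- s) u i d) = \sum_(i <- s) LIM (u i).
Proof.
elim: s => [_|i s IH bu].
  by rewrite big_nil; under eq_fun do rewrite big_nil;
    split; [exact: bounded_net_cst|exact: LIM_cst].
have bi : bounded_net (u i) by apply: bu; rewrite mem_head.
have [bs LIMs] : bounded_net (fun d => \sum_(i <- s) u i d) /\
    LIM (fun d => \sum_(i <- s) u i d) = \sum_(i <- s) LIM (u i).
  by apply: IH => j js; apply: bu; rewrite inE js orbT.
rewrite big_cons -LIMs -LIM_add//; under eq_fun do rewrite big_cons.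
split => //; have := bounded_net_lin 1 1 bi bs.
by under eq_fun do rewrite !mul1r.
Qed.

Lemma LIM_eq d0 u v : bounded_net u -> bounded_net v ->
  (forall d, (d0 `<=` d)%fset -> u d = v d) -> LIM u = LIM v.
Proof.
move=> bu bv uv; apply/eqP; rewrite -subr_eq0 -LIM_sub//; apply/eqP.
apply: banach_limit_cvg => //.
  have := bounded_net_lin 1 (-1) bu bv.
  by under eq_fun do rewrite mul1r mulN1r; exact: bounded_net_fun.
by apply: cvg_near_cst; exists d0 => // d /= d0d; rewrite uv// subrr.
Qed.

(** Only eventual domination is assumed: [u] may be compared with the maximum of
    [u] and [v], which eventually is [v]. *)
Lemma LIM_le d0 u v : bounded_net u -> bounded_net v ->
  (forall d, (d0 `<=` d)%fset -> u d <= v d) -> LIM u <= LIM v.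
Proof.
move=> bu bv uv.
have [C uC] := bu; have [D vD] := bv.
pose m d := Num.max (u d) (v d).
have bm : bounded_net m.
  exists (Num.max C D) => d; rewrite /m le_max.
  by case: (leP (u d) (v d)) => _; rewrite ?uC ?vD ?orbT.
rewrite -(@LIM_eq d0 m v)//; last by move=> d /uv ?; rewrite /m max_r.
rewrite -subr_ge0 -LIM_sub//; apply: banach_limit_ge0 => //.
  have := bounded_net_lin 1 (-1) bm bu.
  by under eq_fun do rewrite mul1r mulN1r; exact: bounded_net_fun.
by move=> d; rewrite subr_ge0 /m le_max lexx.
Qed.

Lemma LIM_ge0 u : bounded_net u -> (forall d, 0 <= u d) -> 0 <= LIM u.
Proof. by move=> /bounded_net_fun bu u0; apply: banach_limit_ge0. Qed.

Lemma LIM_norm_le K u : (forall d, `|u d| <= K) -> `|LIM u| <= K.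
Proof.
move=> uK; have bu : bounded_net u by exists K.
have bK c : bounded_net (fun=> c) by exact: bounded_net_cst.
rewrite ler_norml -{1}(LIM_cst (- K)) -{2}(LIM_cst K).
by apply/andP; split; apply: (@LIM_le fset0) => // d _;
  move: (uK d); rewrite ler_norml => /andP[].
Qed.

End banach_limit_theory.

Section weak_limits.
Context {R : realType} {dT : measure_display} {T : measurableType dT}.
Variable P : probability T R.
Context {disp : Order.disp_t} {Delta : orderType disp}.
Variable LIM : ({fset Delta} -> R) -> R.
Hypothesis LIMP : banach_limit LIM.

Local Notation E := (mean P).
Local Notation L1 := (Lfun P 1%:E).

(** A bound that holds everywhere is needed to apply [indicators_determine]. *)
Lemma ebounded_bounded C (b : T -> R) : ebounded P C b ->
  exists b' : T -> R, [/\ measurable_fun setT b', forall w, `|b' w| <= `|C| &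
    forall Y, Y \in L1 -> E (fun w => b w * Y w) = E (fun w => b' w * Y w)].
Proof.
move=> bC; have [mb babs] := bC.
pose b' w := if `|b w| <= C then b w else 0.
have mb' : measurable_fun setT b'.
  by apply: measurable_fun_ifT => //; apply: measurable_fun_ler => //; exact: measurableT_comp.
exists b'; split => //.
  move=> w; rewrite /b'; case: ifP => [bw|_]; last by rewrite normr0.
  by rewrite (le_trans bw)// ler_norm.
move=> Y /L1_measurable mY; apply: mean_ae_eq; do ?exact: measurable_funM.
by apply: filterS babs => w bw; rewrite /b' bw.
Qed.

Variables (u : {fset Delta} -> T -> R) (K : R).
Hypothesis u1 : forall d, u d \in L1.
Hypothesis u0 : forall d, {ae P, forall w, 0 <= u d w}.
Hypothesis uK : forall d, E (u d) <= K.

Lemma mean_weak_bound C b d : ebounded P C b ->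
  `|E (fun w => b w * u d w)| <= `|C| * K.
Proof.
move=> bC; apply: le_trans (mean_ebounded bC (u1 d)) _.
rewrite (mean_norm_ge0 (u1 d) (u0 d)).
have Eu0 : 0 <= E (u d) by apply: mean_ge0 => //; exact: L1_measurable.
by rewrite (le_trans (ler_wpM2r Eu0 (ler_norm C)))// ler_wpM2l.
Qed.

Lemma bounded_net_weak C b : ebounded P C b ->
  bounded_net (fun d => E (fun w => b w * u d w)).
Proof. by move=> bC; exists (`|C| * K) => d; exact: mean_weak_bound. Qed.

Definition weak_limit (A : set T) := LIM (fun d => E (fun w => \1_A w * u d w)).

Local Notation m := weak_limit.

Let mean_ind1 A d : measurable A -> (fun w => \1_A w * u d w) \in L1.
Proof. by move=> mA; exact: eboundedMl (ebounded_indic P mA) (u1 d). Qed.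

Let bind A : measurable A -> bounded_net (fun d => E (fun w => \1_A w * u d w)).
Proof. by move=> mA; exact: bounded_net_weak (ebounded_indic P mA). Qed.

Lemma weak_limit_ge0 A : measurable A -> 0 <= m A.
Proof.
move=> mA; apply: LIM_ge0 => //; first exact: bind.
move=> d; apply: mean_ge0; first exact/L1_measurable/mean_ind1.
by apply: filterS (u0 d) => w ud; rewrite mulr_ge0.
Qed.

Lemma weak_limit_additive A B : measurable A -> measurable B ->
  A `&` B = set0 -> m (A `|` B) = m A + m B.
Proof.
move=> mA mB AB; rewrite -LIM_add//; [|exact: bind..].
rewrite /weak_limit; congr LIM; apply/funext => d.
rewrite -meanD; [|exact: mean_ind1..].
congr (mean P _); apply/funext => w; rewrite -mulrDl; congr (_ * _).
rewrite !indicE in_setU.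
case: (boolP (w \in A)) (boolP (w \in B)) => [wA|wA] [wB|wB] /=; rewrite ?addr0 ?add0r//.
by have : set0 w by rewrite -AB; split; exact/set_mem.
Qed.

Hypothesis mP : fa_abs_continuous P m.

(** The remainders of a countable disjoint union decrease to the empty set, so
    their probabilities tend to [0] by countable additivity of [P], and their weak
    limits do by absolute continuity. *)
Lemma weak_limit_sigma_additive :
  semi_sigma_additive (fun A => (m A)%:E).
Proof.
move=> B mB tB mUB.
have mBn n : measurable (\big[setU/set0]_(k < n) B k) by exact: bigsetU_measurable.
pose D n := \bigcup_k B k `\` \big[setU/set0]_(k < n) B k.
have mD n : measurable (D n) by exact: measurableD.
have sBn n : \big[setU/set0]_(k < n) B k `<=` \bigcup_k B k.
  exact: bigsetU_bigcup.
have m0 : m set0 = 0.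
  rewrite -[RHS](LIM_cst LIMP) /weak_limit; congr LIM; apply/funext => d.
  by rewrite -[RHS](mean0 P); congr (mean P _); apply/funext => w; rewrite indic0 mul0r.
have mU n : m (\bigcup_k B k) = \sum_(0 <= k < n) m (B k) + m (D n).
  have -> : \sum_(0 <= k < n) m (B k) = m (\big[setU/set0]_(k < n) B k).
    elim: n => [|n IH]; first by rewrite big_ord0 big_nil m0.
    rewrite big_nat_recr//= IH big_ord_recr/= weak_limit_additive//; first exact: mBn.
    apply: (@trivIset_bigsetUI _ xpredT _ _ n n) => //.
    exact: sub_trivIset tB.
  rewrite -weak_limit_additive//; last by rewrite setDIK.
  by rewrite setDUK.
have PD : P (D n) @[n --> \oo] --> 0%E.
  rewrite -(measure0 P); have <- : \bigcap_n D n = set0.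
    rewrite -subset0 => w Dw; have [[k _ Bk] _] := Dw 0%N I.
    have [_] := Dw k.+1 I; apply.
    by rewrite big_ord_recr; right.
  apply: nonincreasing_cvg_mu => //.
  - by rewrite (le_lt_trans (probability_le1 _ _))// ltry.
  - exact: bigcap_measurable.
  - move=> i j ij; apply/subsetPset; apply: setDS.
    exact: subset_bigsetU.
have mD0 : m (D n) @[n --> \oo] --> (0 : R).
  apply/cvgrPdist_lt => e e0.
  have [eta eta0 He] := mP e0.
  have PDe : \forall n \near \oo, (P (D n) < eta%:E)%E.
    have /cvgrPdist_lt fPD : fine (P (D n)) @[n --> \oo] --> (0 : R).
      exact: fine_cvg PD.
    have := fPD _ eta0; apply: filterS => n; rewrite sub0r normrN => PDe.
    rewrite -[P (D n)]fineK ?fin_num_measure// lte_fin.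
    exact: le_lt_trans (ler_norm _) PDe.
  near=> n; rewrite sub0r normrN ger0_norm; last exact: weak_limit_ge0.
  by apply: He => //; near: n.
have -> : (fun n => \sum_(0 <= i < n) (m (B i))%:E)%E =
          EFin \o (fun n => m (\bigcup_k B k) - m (D n)).
  by apply/funext => n /=; rewrite (mU n) addrK sumEFin.
apply: cvg_EFin; first exact/nearW.
rewrite -[X in _ --> X]subr0; apply: cvgB => //; exact: cvg_cst.
Unshelve. all: by end_near. Qed.

(** The density represents the limit on indicator functions; both sides are
    bounded functionals of $b \in L^\infty$, so they agree everywhere. *)
Lemma weak_limit_density : exists M : T -> R,
  [/\ M \in L1, {ae P, forall w, 0 <= M w} &
    forall C b, ebounded P C b -> 
      E (fun w => b w * M w) = LIM (fun d => E (fun w => b w * u d w))].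
Proof.
have m0 : (m set0)%:E = 0%E.
  congr EFin; rewrite -[RHS](LIM_cst LIMP) /weak_limit; congr LIM; apply/funext => d.
  by rewrite -[RHS](mean0 P); congr (mean P _); apply/funext => w; rewrite indic0 mul0r.
pose nuA (A : set T) := (m A)%:E.
have nuA_fin (A : set T) : measurable A -> nuA A \is a fin_num by [].
pose nu : {charge set T -> \bar R} := HB.pack nuA
  (isCharge.Build _ _ _ nuA m0 nuA_fin weak_limit_sigma_additive).
have nuP : nu `<< P.
  apply/null_content_dominatesP => A mA PA; congr EFin; apply/eqP.
  rewrite eq_le weak_limit_ge0// andbT; apply/ler_addgt0Pl => e e0.
  have [eta eta0 /(_ A mA)] := mP e0.
  by rewrite PA lte_fin eta0 addr0 => /(_ isT)/ltW.
pose f := Radon_Nikodym nu P.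
have ffin w : f w \is a fin_num by exact: Radon_Nikodym_fin_num.
have fint : P.-integrable setT f by exact: Radon_Nikodym_integrable.
pose M := fine \o f.
have fE : EFin \o M = f by apply/funext => w; rewrite /M /= fineK.
have M1 : M \in L1 by apply/L1P; rewrite fE.
have sT := @sigma_algebra_measurable _ T.
have mT : measurable `<=` @measurable _ T by [].
have MA A : measurable A -> E (fun w => \1_A w * M w) = m A.
  move=> mA; apply: EFin_inj; rewrite -(integral_mean mT)//.
  transitivity (nu A) => //.
  rewrite (Radon_Nikodym_integral nuP mA).
  by apply: eq_integral => w _; rewrite /M /= fineK.
have GM : measurable_wrt measurable M.
  by move=> A mA; rewrite -[X in measurable X]setTI; exact: (L1_measurable M1).
exists M; split => //.
  by apply: (ae_ge0_of_mean mT) => // A mA; rewrite MA// weak_limit_ge0.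
move=> C b bC; have [b' [mb' b'C bE]] := ebounded_bounded bC.
rewrite bE//; under [in RHS]eq_fun do rewrite bE//.
apply/eqP; rewrite -subr_eq0; apply/eqP.
apply: (indicators_determine (L := fun b =>
  E (fun w => b w * M w) - LIM (fun d => E (fun w => b w * u d w)))
  sT (K := E (fun w => `|M w|) + K)) b'C.
- move=> a c b1 b2 D Gb1 Gb2 b1D b2D.
  have eb1 : ebounded P D b1.
    by apply: ebounded_le => //; exact: measurable_wrt_measurable Gb1.
  have eb2 : ebounded P D b2.
    by apply: ebounded_le => //; exact: measurable_wrt_measurable Gb2.
  have lin Y : Y \in L1 -> E (fun w => (a * b1 w + c * b2 w) * Y w) =
      a * E (fun w => b1 w * Y w) + c * E (fun w => b2 w * Y w).
    move=> Y1; have Y11 := eboundedMl eb1 Y1; have Y12 := eboundedMl eb2 Y1.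
    rewrite -!meanZ// -meanD; [|exact: L1Z..].
    by congr (mean P _); apply/funext => w; ring.
  rewrite lin//; have -> : (fun d => E (fun w => (a * b1 w + c * b2 w) * u d w)) =
      fun d => a * E (fun w => b1 w * u d w) + c * E (fun w => b2 w * u d w).
    by apply/funext => d; rewrite lin.
  rewrite LIM_lin//; [|exact: bounded_net_weak eb1|exact: bounded_net_weak eb2].
  ring.
- move=> b1 Gb1 b101.
  have b11 w : `|b1 w| <= 1 by have /andP[? ?] := b101 w; rewrite ger0_norm.
  have eb1 : ebounded P 1 b1.
    by apply: ebounded_le => //; exact: measurable_wrt_measurable Gb1.
  rewrite (le_trans (ler_normB _ _))// lerD//.
    by rewrite (le_trans (mean_ebounded eb1 M1))// mul1r.
  apply: (LIM_norm_le LIMP) => d.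
  by rewrite (le_trans (mean_weak_bound d eb1))// normr1 mul1r.
- by move=> A mA; rewrite MA// subrr.
- by move=> A mA; rewrite -[X in measurable X]setTI; exact: mb'.
Qed.

End weak_limits.

(** * Steps of a finite grid *)

Section grid_theory.
Context {disp : Order.disp_t} {Delta : orderType disp}.
Implicit Types (d : {fset Delta}) (p q : Delta * Delta) (s t x y : Delta).

Local Notation sorted_grid d := (sort <=%O (enum_fset d)).

Lemma sorted_grid_lt d : sorted <%O (sorted_grid d).
Proof. by rewrite lt_sorted_uniq_le sort_uniq fset_uniq sort_le_sorted. Qed.

Lemma mem_zip_behead x (l : seq Delta) p : p \in zip (x :: l) l ->
  p.1 \in x :: l /\ p.2 \in l.
Proof.
elim: l x => [|y l IH] x //; rewrite inE => /predU1P[->|/IH[p1 p2]] /=.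
  by rewrite !inE !eqxx.
by rewrite inE p1 orbT inE p2 orbT.
Qed.

(** The pairs of neighbours in a strictly increasing sequence [x :: l], a form of
    the steps of a grid that is suited to induction on [l]. *)
Lemma path_zip_consecutive x (l : seq Delta) p t : path <%O x l ->
  p \in zip (x :: l) l -> t \in x :: l ->
  (p.1 < p.2)%O /\ ((t <= p.1)%O \/ (p.2 <= t)%O).
Proof.
elim: l x t => [|y l IH] x t //= /andP[xy yl].
have lowest z : z \in y :: l -> (y <= z)%O.
  move: (yl); rewrite lt_path_sortedE => /andP[/allP yall _].
  by rewrite inE => /predU1P[->//|/yall/ltW].
rewrite inE => /predU1P[->/=|pl].
  by rewrite inE => /predU1P[->|/lowest yt]; split => //;
    first [by left|by right].
rewrite inE => /predU1P[->|tl]; last exact: (IH y t yl pl tl).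
split; first by have [] := IH y y yl pl (mem_head _ _).
by left; apply: ltW; apply: lt_le_trans xy _; apply: lowest; have [] := mem_zip_behead pl.
Qed.

Lemma path_zip_telescope {V : zmodType} (g : Delta -> V) x (l : seq Delta) t :
  path <%O x l -> t \in x :: l ->
  \sum_(p <- zip (x :: l) l | (p.2 <= t)%O) (g p.2 - g p.1) = g t - g x.
Proof.
elim: l x => [|y l IH] x /=.
  by move=> _; rewrite inE big_nil => /eqP ->; rewrite subrr.
move=> /andP[xy yl]; rewrite big_cons /= inE => /predU1P[->|tl].
  rewrite leNgt xy /= big_seq_cond big1 ?subrr// => p /andP[pl].
  have [_ p2] := mem_zip_behead pl.
  move: yl; rewrite lt_path_sortedE => /andP[/allP /(_ _ p2) yp _].
  by rewrite leNgt (lt_trans xy yp).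
rewrite IH//; case: ifP => [_|/negP[]].
  by rewrite addrC addrA subrK.
move: yl tl; rewrite lt_path_sortedE inE => /andP[/allP yall _].
by move=> /predU1P[->//|/yall/ltW].
Qed.

Lemma path_zip_indic_cases {R : realType} x (l : seq Delta) t : path <%O x l ->
  (exists2 p, p \in zip (x :: l) l & forall c : Delta * Delta -> R,
     \sum_(q <- zip (x :: l) l) c q * \1_(ocitv q) t = c p) \/
  (forall c : Delta * Delta -> R,
     \sum_(q <- zip (x :: l) l) c q * \1_(ocitv q) t = 0).
Proof.
elim: l x => [|y l IH] x /=; first by right=> c; rewrite big_nil.
move=> /andP[xy yl].
have [xty|xty] := boolP (x < t <= y)%O.
  left; exists (x, y); first by rewrite inE eqxx.
  move=> c; rewrite big_cons indicE mem_set; last by rewrite /ocitv /= in_itv.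
  rewrite /= mulr1 big_seq big1 ?addr0// => q ql.
  rewrite indicE memNset ?mulr0// /ocitv /= in_itv /= => /andP[qt _].
  have [q1 _] := mem_zip_behead ql.
  have : (y <= q.1)%O.
    move: yl q1; rewrite lt_path_sortedE inE => /andP[/allP yall _].
    by move=> /predU1P[->//|/yall/ltW].
  by case/andP: xty => _ ty; rewrite leNgt (lt_le_trans qt ty).
have head0 (c : Delta * Delta -> R) : c (x, y) * \1_(ocitv (x, y)) t = 0.
  by rewrite indicE memNset ?mulr0// /ocitv /= in_itv /=; apply/negP.
have [[p pl pc]|c0] := IH y yl.
  left; exists p; first by rewrite inE pl orbT.
  by move=> c; rewrite big_cons head0 add0r pc.
by right => c; rewrite big_cons head0 add0r c0.
Qed.

Lemma stepsE d : (steps d = [::] /\ forall t, t \notin d) \/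
  exists x l, [/\ steps d = zip (x :: l) l, path <%O x l & d =i x :: l].
Proof.
rewrite /steps; have := sorted_grid_lt d.
have : d =i sorted_grid d by move=> t; rewrite mem_sort.
case: (sorted_grid d) => [|x l] dE dlt; [left|by right; exists x, l].
by split => // t; rewrite dE.
Qed.

Lemma steps_mem d p : p \in steps d ->
  [/\ (p.1 < p.2)%O, p.1 \in d & p.2 \in d].
Proof.
have [[->]//|[x [l [-> xl dE]]] pl] := stepsE d.
have [p1 p2] := mem_zip_behead pl.
split; rewrite ?dE//; last by rewrite inE p2 orbT.
by have [] := path_zip_consecutive xl pl p1.
Qed.

Lemma steps_consecutive d p t : p \in steps d -> t \in d ->
  (t <= p.1)%O \/ (p.2 <= t)%O.
Proof.
have [[->]//|[x [l [-> xl dE]]] pl] := stepsE d.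
by rewrite dE => /(path_zip_consecutive xl pl)[].
Qed.

Lemma steps_from d p t : p \in steps d -> t \in d ->
  (t < p.2)%O -> (t <= p.1)%O.
Proof.
by move=> pd td tp; have [//|] := steps_consecutive pd td; rewrite leNgt tp.
Qed.

Lemma grid_bounds d s : s \in d -> exists lo hi, [/\ lo \in d, hi \in d &
  forall t, t \in d -> (lo <= t <= hi)%O].
Proof.
move=> sd; have := sorted_grid_lt d.
have dE : d =i sorted_grid d by move=> t; rewrite mem_sort.
case E : (sorted_grid d) dE => [|x l] dE /= xl.
  by move: sd; rewrite dE.
exists x, (last x l); split; rewrite ?dE ?mem_head ?mem_last//.
move=> t; rewrite dE => tl; apply/andP; split.
  move: xl tl; rewrite lt_path_sortedE inE => /andP[/allP xall _].
  by move=> /predU1P[->//|/xall/ltW].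
elim: l x t xl tl {E dE} => [|y l IH] x t /=; first by rewrite inE => _ /eqP ->.
move=> /andP[xy yl]; rewrite inE => /predU1P[->|]; last exact: IH.
by apply: le_trans (ltW xy) _; exact: (IH y y yl (mem_head _ _)).
Qed.

Lemma steps_telescope {V : zmodType} (g : Delta -> V) d s t :
  s \in d -> t \in d -> (s <= t)%O ->
  \sum_(p <- steps d | (s < p.2 <= t)%O) (g p.2 - g p.1) = g t - g s.
Proof.
have [[_ d0]|[x [l [E xl dE]]]] := stepsE d; first by rewrite (negbTE (d0 s)).
rewrite !dE => sd td st.
have gt := path_zip_telescope g xl td; have gs := path_zip_telescope g xl sd.
have -> : g t - g s = (g t - g x) - (g s - g x) by rewrite opprB addrA subrK.
rewrite -gt -gs -E [X in _ = X - _](bigID (fun p => p.2 <= s)%O) /= addrC.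
have -> : \sum_(p <- steps d | (p.2 <= t)%O && (p.2 <= s)%O) (g p.2 - g p.1) =
          \sum_(p <- steps d | (p.2 <= s)%O) (g p.2 - g p.1).
  apply: eq_bigl => p; case: (leP p.2 s) => [ps|]; last by rewrite andbF.
  by rewrite (le_trans ps st).
rewrite -addrA subrr addr0.
by apply: eq_bigl => p; rewrite ltNge andbC.
Qed.

(** The half-open intervals of a grid are disjoint: at each time, at most one
    term of a simple process is present. *)
Lemma steps_indic_cases {R : realType} d t :
  (exists2 p, p \in steps d & forall c : Delta * Delta -> R,
     \sum_(q <- steps d) c q * \1_(ocitv q) t = c p) \/
  (forall c : Delta * Delta -> R,
     \sum_(q <- steps d) c q * \1_(ocitv q) t = 0).
Proof.
have [[-> _]|[x [l [-> xl _]]]] := stepsE d; last exact: path_zip_indic_cases.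
by right => c; rewrite big_nil.
Qed.

Lemma steps_pair s t : (s < t)%O -> steps [fset s; t]%fset = [:: (s, t)].
Proof.
move=> st; rewrite /steps.
suff -> : sort <=%O (enum_fset [fset s; t]%fset) = [:: s; t] by [].
apply: lt_sorted_eq; [exact: sorted_grid_lt|by rewrite /= st|].
by move=> r; rewrite mem_sort !inE.
Qed.

End grid_theory.

(** * Drifts and compensators *)

Section compensators.
Context {R : realType} {dT : measure_display} {T : measurableType dT}.
Context {disp : Order.disp_t} {Delta : orderType disp}.
Variable P : probability T R.
Variable F : Delta -> set (set T).
Hypothesis filtF : filtration P F.
Implicit Types (X A : Delta -> T -> R) (p q : Delta * Delta) (s t : Delta).
Implicit Types (d : {fset Delta}) (D : pred Delta) (b M : T -> R) (C : R).

Local Notation E := (mean P).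
Local Notation L1 := (Lfun P 1%:E).
Local Notation cond s := (condexp P (F s)).

Lemma filtration_sigma_algebra s : sigma_algebra setT (F s).
Proof. by have [] := filtF. Qed.

Lemma filtration_measurable s : F s `<=` measurable.
Proof. by have [] := filtF. Qed.

Lemma filtration_mono s t : (s <= t)%O -> F s `<=` F t.
Proof. by have [_ _ + _] := filtF; apply. Qed.

Local Notation FS := (filtration_sigma_algebra _).
Local Notation FM := (@filtration_measurable _).

Lemma cond_L1 s (Y : T -> R) : Y \in L1 -> cond s Y \in L1.
Proof. exact: (condexp_L1 FS FM). Qed.

Lemma cond_measurable s (Y : T -> R) : Y \in L1 -> measurable_wrt (F s) (cond s Y).
Proof. exact: (condexp_measurable FS FM). Qed.

Lemma measurable_wrt_mono s t (f : T -> R) : (s <= t)%O ->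
  measurable_wrt (F s) f -> measurable_wrt (F t) f.
Proof. by move=> st Ff B mB; apply: filtration_mono st _ _; exact: Ff. Qed.

Definition drift X p (w : T) : R := X p.1 w - cond p.1 (X p.2) w.

(** When [D] is a set of times up to [t], this is the value at [t] of the
    increasing process in the Doob decomposition of [X] along the grid [d].  A
    general [D] also covers its increments and its terminal value. *)
Definition compensator X D d (w : T) : R :=
  \sum_(p <- steps d | D p.2) drift X p w.

Lemma compensator_diff X s t d w : (s <= t)%O ->
  compensator X (fun r => r <= t)%O d w - compensator X (fun r => r <= s)%O d w =
  compensator X (fun r => s < r <= t)%O d w.
Proof.
move=> st; rewrite /compensator.
rewrite [X in X - _](bigID (fun p => p.2 <= s)%O) /= [X in X - _]addrC.
have -> : \sum_(p <- steps d | (p.2 <= t)%O && (p.2 <= s)%O) drift X p w =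
          \sum_(p <- steps d | (p.2 <= s)%O) drift X p w.
  apply: eq_bigl => p; case: (leP p.2 s) => [ps|]; last by rewrite andbF.
  by rewrite (le_trans ps st).
rewrite addrK.
by apply: eq_bigl => p; rewrite ltNge andbC.
Qed.

Lemma compensator_split X D D' d w :
  compensator X D d w = compensator X (fun r => D r && D' r) d w +
                        compensator X (fun r => D r && ~~ D' r) d w.
Proof. by rewrite /compensator (bigID (fun p => D' p.2)). Qed.

Lemma ae_sum_ge0 I (l : seq I) (h : pred I) (f : I -> T -> R) :
  (forall i, h i -> {ae P, forall w, 0 <= f i w}) ->
  {ae P, forall w, 0 <= \sum_(i <- l | h i) f i w}.
Proof.
move=> f0; elim: l => [|i l IH].
  by apply/nearW => w; rewrite big_nil.
case: (boolP (h i)) => hi.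
  by apply: filterS2 (f0 _ hi) IH => w ? ?; rewrite big_cons hi addr_ge0.
by apply: filterS IH => w; rewrite big_cons (negbTE hi).
Qed.

Section drift.
Variable X : Delta -> T -> R.
Hypothesis aX : adapted F X.
Hypothesis X1 : forall s, X s \in L1.

Lemma drift_L1 p : drift X p \in L1.
Proof. by apply: L1B => //; exact: cond_L1. Qed.

Lemma drift_measurable p : measurable_wrt (F p.1) (drift X p).
Proof.
apply: measurable_wrtB => //; first exact: FS.
exact: cond_measurable.
Qed.

Lemma mean_mul_drift C b p : ebounded P C b -> measurable_wrt (F p.1) b ->
  E (fun w => b w * drift X p w) =
  E (fun w => b w * X p.1 w) - E (fun w => b w * X p.2 w).
Proof.
move=> bC Fb; under eq_fun do rewrite /drift mulrBr.
have c1 : cond p.1 (X p.2) \in L1 by exact: cond_L1.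
rewrite meanB; [|exact: eboundedMl bC _..].
by rewrite (mean_mul_condexp FS FM)//; exact: eboundedMl bC _.
Qed.

Lemma mean_drift p : E (drift X p) = E (X p.1) - E (X p.2).
Proof.
rewrite meanB//; last exact: cond_L1.
by rewrite (mean_condexp FS FM).
Qed.

Lemma compensator_L1 D d : compensator X D d \in L1.
Proof. by apply: L1_sum => p _; exact: drift_L1. Qed.

Lemma compensator_measurable t d :
  measurable_wrt (F t) (compensator X (fun r => r <= t)%O d).
Proof.
rewrite /compensator (_ : (fun _ => _) = fun w => \sum_(p <- steps d |
    (p.2 <= t)%O && (p \in steps d)) drift X p w); last first.
  by apply/funext => w; rewrite big_seq_cond; apply: eq_bigl => p; rewrite andbC.
apply: measurable_wrt_sum; first exact: FS.
move=> p /andP[pt /steps_mem[p12 _ _]].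
apply: measurable_wrt_mono (drift_measurable p).
exact: le_trans (ltW p12) pt.
Qed.

Lemma mean_mul_compensator C b D d : ebounded P C b ->
  E (fun w => b w * compensator X D d w) =
  \sum_(p <- steps d | D p.2) E (fun w => b w * drift X p w).
Proof.
move=> bC; rewrite -mean_sum; last by move=> p _; exact: eboundedMl bC (drift_L1 p).
by congr (mean P _); apply/funext => w; rewrite /compensator mulr_sumr.
Qed.

(** Each step after [s] starts at or after [s], because [s] is in the grid; so
    [b] is known at its start, the conditional expectation in its drift may be
    dropped, and the sum telescopes. *)
Lemma mean_compensator_between C b s t d : s \in d -> t \in d -> (s <= t)%O ->
  ebounded P C b -> measurable_wrt (F s) b ->
  E (fun w => b w * compensator X (fun r => s < r <= t)%O d w) =
  E (fun w => b w * X s w) - E (fun w => b w * X t w).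
Proof.
move=> sd td st bC Fb; rewrite (mean_mul_compensator _ _ bC).
pose g r := - E (fun w => b w * X r w).
transitivity (\sum_(p <- steps d | (s < p.2 <= t)%O) (g p.2 - g p.1)); last first.
  by rewrite steps_telescope// /g opprK addrC.
rewrite big_seq_cond [RHS]big_seq_cond; apply: eq_bigr => p /andP[pd /andP[sp _]].
rewrite (mean_mul_drift bC) /g ?opprK 1?addrC//.
by apply: measurable_wrt_mono Fb; exact: steps_from pd sd sp.
Qed.

Lemma ebounded1 : ebounded P 1 (fun=> 1).
Proof. by split => //; apply/nearW => w; rewrite normr1. Qed.

Lemma mean_compensator_between1 s t d : s \in d -> t \in d -> (s <= t)%O ->
  E (compensator X (fun r => s < r <= t)%O d) = E (X s) - E (X t).
Proof.
move=> sd td st.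
have := mean_compensator_between sd td st ebounded1.
have e f : (fun w => 1 * f w) = f :> (T -> R) by apply/funext => w; rewrite mul1r.
rewrite !e; apply; apply: measurable_wrt_cst; exact: FS.
Qed.

Hypothesis drift0 : forall p, (p.1 <= p.2)%O -> {ae P, forall w, 0 <= drift X p w}.

Lemma compensator_ge0 D d : {ae P, forall w, 0 <= compensator X D d w}.
Proof.
have H : {ae P, forall w, 0 <= \sum_(p <- steps d | D p.2 && (p \in steps d)) drift X p w}.
  by apply: ae_sum_ge0 => p /andP[_ /steps_mem[p12 _ _]]; exact/drift0/ltW.
apply: filterS H => w; congr (_ <= _); rewrite [RHS]big_seq_cond.
by apply: eq_bigl => p; rewrite andbC.
Qed.

Lemma mean_compensator_ge0 D d : 0 <= E (compensator X D d).
Proof. by apply: mean_ge0 (compensator_ge0 D d); exact: L1_measurable (compensator_L1 D d). Qed.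

Lemma mean_compensator_le D d : E (compensator X D d) <= E (compensator X predT d).
Proof.
have -> : compensator X predT d = fun w =>
    compensator X D d w + compensator X (fun r => ~~ D r) d w.
  by apply/funext => w; exact: (compensator_split X predT D d w).
by rewrite meanD ?lerDl ?mean_compensator_ge0//; exact: compensator_L1.
Qed.

End drift.

(** The martingale part of [X] has no drift, by the tower property. *)
Lemma drift_decomposition X A M p : (p.1 <= p.2)%O ->
  adapted F A -> (forall s, A s \in L1) -> M \in L1 -> (forall s, X s \in L1) ->
  (forall s, {ae P, forall w, X s w = cond s M w - A s w}) ->
  {ae P, forall w, drift X p w = cond p.1 (A p.2) w - A p.1 w}.
Proof.
move=> p12 aA A1 M1 X1 XE.
have cM1 s : cond s M \in L1 by exact: cond_L1.
have cA1 : cond p.1 (A p.2) \in L1 by exact: cond_L1.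
have cXE : {ae P, forall w, cond p.1 (X p.2) w = cond p.1 M w - cond p.1 (A p.2) w}.
  apply: (condexp_ae_eq FS FM) => //; first exact: L1B.
    by apply: measurable_wrtB; [exact: FS|exact: cond_measurable..].
  move=> B FB; have eB := ebounded_indic P (FM FB).
  have FB' := filtration_mono p12 FB.
  have IL (Y : T -> R) : Y \in L1 -> (fun w => \1_B w * Y w) \in L1.
    exact: eboundedMl eB.
  under eq_fun do rewrite mulrBr.
  rewrite meanB; [|exact: IL..].
  rewrite !(mean_condexp_set FS FM FB)//.
  rewrite -(mean_condexp_set FS FM FB' M1) -meanB; [|exact: IL..].
  apply: mean_ae_eq.
  - by apply: (@L1_measurable _ _ _ P); apply: L1B; exact: IL.
  - by apply: (@L1_measurable _ _ _ P); exact: IL.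
  - by apply: filterS (XE p.2) => w ->; rewrite mulrBr.
apply: filterS2 (XE p.1) cXE => w; rewrite /drift => -> ->; ring.
Qed.

End compensators.

(** * Natural increasing processes *)

Section grid_sums.
Context {R : realType} {disp : Order.disp_t} {Delta : orderType disp}.

Lemma indic_ocitv (p : Delta * Delta) t :
  \1_(ocitv p) t = (p.1 < t <= p.2)%O%:R :> R.
Proof.
by rewrite indicE; congr (_%:R); congr nat_of_bool; apply/idP/idP;
  rewrite inE /ocitv /= in_itv.
Qed.

Lemma steps_variation_le (g : Delta -> R) K (d : {fset Delta}) :
  0 <= K -> (forall s, 0 <= g s <= K) ->
  \sum_(p <- steps d) (g p.2 - g p.1) <= K.
Proof.
move=> K0 gK.
case E : (steps d) => [|p0 l]; first by rewrite big_nil.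
have [_ p0d _] : [/\ (p0.1 < p0.2)%O, p0.1 \in d & p0.2 \in d].
  by apply: steps_mem; rewrite E mem_head.
have [lo [hi [lod hid lohi]]] := grid_bounds p0d.
have /andP[_ lehi] := lohi _ lod.
have := steps_telescope g lod hid lehi.
rewrite -E big_seq_cond; rewrite big_seq => H.
have -> : \sum_(i <- steps d | i \in steps d) (g i.2 - g i.1) = g hi - g lo.
  rewrite -H; apply: eq_bigl => p; case: (boolP (p \in steps d)) => //= pd.
  have [p12 p1 p2] := steps_mem pd.
  have /andP[lop1 _] := lohi _ p1; have /andP[_ ->] := lohi _ p2.
  by rewrite (le_lt_trans lop1 p12).
have /andP[_ ghi] := gK hi; have /andP[glo _] := gK lo.
by rewrite (le_trans _ ghi)// gerBl.
Qed.

End grid_sums.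

Section natural_processes.
Context {R : realType} {dT : measure_display} {T : measurableType dT}.
Context {disp : Order.disp_t} {Delta : orderType disp}.
Variable P : probability T R.
Variable F : Delta -> set (set T).
Hypothesis filtF : filtration P F.
Variable LIM : ({fset Delta} -> R) -> R.
Hypothesis LIMP : banach_limit LIM.

Local Notation E := (mean P).
Local Notation L1 := (Lfun P 1%:E).
Local Notation cond s := (condexp P (F s)).
Local Notation FS := (filtration_sigma_algebra filtF _).
Local Notation FM := (@filtration_measurable _ _ _ _ _ _ _ filtF _).

Lemma bounded_fun_ex (f : T -> R) : bounded_fun f -> exists K, forall w, `|f w| <= K.
Proof.
move=> [K [_ HK]]; exists (K + 1) => w.
by apply: (HK (K + 1)) => //; rewrite ltrDl.
Qed.

Lemma pred_fun_bounded d0 (f : T * Delta -> R) : pred_fun F d0 f ->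
  exists D, 0 <= D /\ forall v, `|f v| <= D.
Proof.
move=> [c Fc ->].
elim: (steps d0) Fc => [|p l IH] Fc.
  by exists 0; split => // v; rewrite big_nil normr0.
have [D [D0 DP]] := IH (fun q ql => Fc q (mem_behead (s := p :: l) ql)).
have [_ /bounded_fun_ex[K KP]] := Fc p (mem_head _ _).
exists (`|K| + D); split; first exact: addr_ge0.
move=> v; rewrite big_cons (le_trans (ler_normD _ _))// lerD//.
rewrite normrM indic_ocitv normr_nat.
case: (_ < _ <= _)%O; rewrite ?mulr1 ?mulr0//.
by rewrite (le_trans (KP _))// ler_norm.
Qed.

Lemma pred_proj_ebounded C (b : T -> R) d t : 0 <= C -> ebounded P C b ->
  ebounded P C (fun w => pred_proj P F d (fun v => b v.1) (w, t)).
Proof.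
move=> C0 bC; rewrite /pred_proj /=.
have [[p pd pE]|E0] := @steps_indic_cases _ _ R d t.
  rewrite (_ : (fun _ => _) = cond p.1 b); first exact: condexp_ebounded FS FM _ _ bC.
  by apply/funext => w; rewrite (pE (fun q => cond q.1 b w)).
rewrite (_ : (fun _ => _) = fun=> 0).
  by split; [exact: measurable_cst|apply/nearW => w; rewrite normr0].
by apply/funext => w; rewrite (E0 (fun q => cond q.1 b w)).
Qed.

Lemma pred_fun_ebounded d0 (f : T * Delta -> R) D t : pred_fun F d0 f ->
  (forall v, `|f v| <= D) -> ebounded P D (fun w => f (w, t)).
Proof.
move=> [c Fc ->] fD; apply: ebounded_le => //.
have mT : measurable `<=` @measurable _ T by [].
apply: (measurable_wrt_measurable mT).
rewrite (_ : (fun _ => _) = fun w => \sum_(p <- steps d0 | p \in steps d0)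
    c p.1 w * \1_(ocitv p) t); last by apply/funext => w; rewrite big_seq.
have sT := @sigma_algebra_measurable _ T.
apply: measurable_wrt_sum => // p pd; apply: measurable_wrtM => //.
  by have [Fcp _] := Fc p pd; move=> B mB; apply: FM; exact: Fcp.
exact: measurable_wrt_cst.
Qed.

Section process.
Variables X A : Delta -> T -> R.
Hypothesis X1 : forall s, X s \in L1.
Hypothesis aA : adapted F A.
Hypothesis A1 : forall s, A s \in L1.
Hypothesis XA : forall p, (p.1 <= p.2)%O ->
  {ae P, forall w, drift P F X p w = cond p.1 (A p.2) w - A p.1 w}.

(** As [d] refines [d0], the coefficient of the integrand over a step of [d] is
    known at the start of that step, and [mean_condexp_increment] turns the
    increment of [A] into the drift of [X].  Grouping the steps of [d] by the
    step of [d0] that contains them gives the compensators. *)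
Lemma natural_netE C (b : T -> R) (c : Delta -> T -> R) d0 d :
  ebounded P C b ->
  (forall p, p \in steps d0 -> bounded_measurable (F p.1) (c p.1)) ->
  (d0 `<=` d)%fset ->
  E (sint (d `|` d0)%fset (fun w => pred_proj P F d (fun v => b v.1) w *
       \sum_(p <- steps d0) c p.1 w.1 * \1_(ocitv p) w.2) A) =
  \sum_(p <- steps d0) E (fun w => b w * c p.1 w *
    compensator P F X (fun r => p.1 < r <= p.2)%O d w).
Proof.
move=> bC Fc d0d.
pose f := fun v : T * Delta => \sum_(p <- steps d0) c p.1 v.1 * \1_(ocitv p) v.2.
have [D [D0 fD]] : exists D, 0 <= D /\ forall v, `|f v| <= D.
  by apply: (@pred_fun_bounded d0); exists c.
have -> : (d `|` d0)%fset = d by apply/fsetUidPl.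
rewrite /sint.
have Ff q : q \in steps d -> measurable_wrt (F q.1) (fun w => f (w, q.2)).
  move=> qd.
  rewrite (_ : (fun _ => _) = fun w => \sum_(p <- steps d0 |
      (p \in steps d0) && (p.1 < q.2 <= p.2)%O) c p.1 w).
    apply: measurable_wrt_sum; first exact: FS.
    move=> p /andP[pd /andP[pq _]].
    have [Fcp _] := Fc _ pd; apply: (measurable_wrt_mono filtF) Fcp.
    have [_ p1 _] := steps_mem pd.
    by apply: steps_from qd _ pq; exact: (fsubsetP d0d).
  apply/funext => w; rewrite /f big_seq [RHS]big_mkcondr; apply: eq_bigr => p _.
  by rewrite /= indic_ocitv; case: ifP; rewrite ?mulr1 ?mulr0.
have fDe q : q \in steps d -> ebounded P D (fun w => f (w, q.2)).
  by move=> qd; apply: ebounded_le => //; exact: measurable_wrt_measurable FM (Ff q qd).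
have bc p : p \in steps d0 -> exists K, ebounded P K (fun w => b w * c p.1 w).
  move=> pd; have [Fcp /bounded_fun_ex[K cK]] := Fc p pd.
  exists (C * K); apply: eboundedM => //; apply: ebounded_le => //.
  exact: measurable_wrt_measurable FM Fcp.
transitivity (\sum_(q <- steps d) E (fun w => b w * f (w, q.2) * drift P F X q w)).
  transitivity (E (fun w => \sum_(q <- steps d | q \in steps d)
      cond q.1 b w * f (w, q.2) * (A q.2 w - A q.1 w))).
    congr (mean P _); apply/funext => w; rewrite big_seq; apply: eq_bigr => q qd.
    by rewrite /pred_proj (sum_steps_indic (fun q => cond q.1 b w) qd).
  rewrite mean_sum; last first.
    move=> q qd; apply: eboundedMl (L1B (A1 _) (A1 _)).
    by apply: eboundedM (fDe q qd); exact: condexp_ebounded FS FM _ _ bC.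
  rewrite [RHS]big_seq; apply: eq_bigr => q qd.
  rewrite (mean_condexp_increment FS FM bC (fDe q qd))//; last exact: Ff.
  have bf := eboundedM bC (fDe q qd).
  apply: mean_ae_eq.
  - apply: (@L1_measurable _ _ _ P); apply: eboundedMl bf _.
    by apply: L1B => //; exact: cond_L1.
  - apply: (@L1_measurable _ _ _ P); apply: eboundedMl bf _.
    exact: drift_L1.
  - have [q12 _ _] := steps_mem qd.
    by apply: filterS (XA (ltW q12)) => w ->.
transitivity (\sum_(q <- steps d) \sum_(p <- steps d0)
   (if (p.1 < q.2 <= p.2)%O then E (fun w => b w * c p.1 w * drift P F X q w) else 0)).
  rewrite big_seq [RHS]big_seq; apply: eq_bigr => q qd.
  rewrite -big_mkcond big_seq_cond -mean_sum; last first.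
    move=> p /andP[pd _]; have [K bcK] := bc p pd.
    by apply: eboundedMl bcK _; exact: drift_L1.
  congr (mean P _); apply/funext => w.
  rewrite /f mulr_sumr mulr_suml -big_seq_cond [RHS]big_mkcond; apply: eq_bigr => p _ /=.
  by rewrite indic_ocitv; case: ifP; rewrite ?mulr1 ?mulr0 ?mul0r// mulrA.
rewrite exchange_big /= big_seq [RHS]big_seq; apply: eq_bigr => p pd.
have [K bcK] := bc p pd.
by rewrite (mean_mul_compensator filtF X1 _ _ bcK) -big_mkcond.
Qed.

Variable K : R.
Hypothesis Amono : forall s t, (s <= t)%O -> {ae P, forall w, A s w <= A t w}.
Hypothesis K0 : 0 <= K.
Hypothesis AK : forall s, 0 <= E (A s) <= K.

(** A Banach limit is linear on bounded nets only, so a bound is needed for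
    every [d], including those that do not refine [d0].  It comes from the total
    increase of [A] being at most [K] in mean. *)
Lemma natural_net_bounded C (b : T -> R) d0 (f : T * Delta -> R) :
  ebounded P C b -> pred_fun F d0 f ->
  bounded_net (fun d => E (sint (d `|` d0)%fset
    (fun w => pred_proj P F d (fun v => b v.1) w * f w) A)).
Proof.
move=> bC Ff; have [D [D0 fD]] := pred_fun_bounded Ff.
have bC' := ebounded_norm bC.
exists (`|C| * D * K) => d; rewrite /sint.
have hC t := eboundedM (pred_proj_ebounded d t (normr_ge0 C) bC')
                      (pred_fun_ebounded t Ff fD).
have dA1 (q : Delta * Delta) : (fun w => A q.2 w - A q.1 w) \in L1 by exact: L1B.
rewrite mean_sum; last by move=> q _; exact: eboundedMl (hC q.2) (dA1 q).
rewrite (le_trans (ler_norm_sum _ _ _))//.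
apply: (@le_trans _ _ (\sum_(q <- steps (d `|` d0)%fset)
    `|C| * D * (E (A q.2) - E (A q.1)))).
  rewrite big_seq [leRHS]big_seq; apply: ler_sum => q qd.
  rewrite (le_trans (mean_ebounded (hC q.2) (dA1 q)))// ler_wpM2l ?mulr_ge0//.
  rewrite -meanB// mean_norm_ge0//; have [q12 _ _] := steps_mem qd.
  by apply: filterS (Amono (ltW q12)) => w; rewrite subr_ge0.
rewrite -mulr_sumr ler_wpM2l ?mulr_ge0//.
by apply: (steps_variation_le (g := fun s => E (A s))).
Qed.

Variable V : R.
Hypothesis drift0 : forall p, (p.1 <= p.2)%O ->
  {ae P, forall w, 0 <= drift P F X p w}.
Hypothesis compV : forall d, E (compensator P F X predT d) <= V.

Lemma compensator_net_bounded C (b : T -> R) D : ebounded P C b ->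
  bounded_net (fun d => E (fun w => b w * compensator P F X D d w)).
Proof.
apply: (bounded_net_weak (K := V)) => d.
- exact: compensator_L1.
- exact: compensator_ge0.
- exact: le_trans (mean_compensator_le filtF X1 drift0 _ _) (compV _).
Qed.

(** This says that, along the Banach limit, the increments of the compensators of
    [X] tend to those of [A] in the weak topology of $L^1$. *)
Definition compensator_limit :=
  forall C (b : T -> R) s t, ebounded P C b -> (s <= t)%O ->
    E (fun w => b w * (A t w - A s w)) =
    LIM (fun d => E (fun w => b w * compensator P F X (fun r => s < r <= t)%O d w)).

(** Naturalness is applied to the integrand $1_{]s,t]}$, which is predictable for
    the grid with the two points [s] and [t]. *)
Lemma natural_compensator_limit : natural P F LIM A -> compensator_limit.
Proof.
move=> natA C b s t bC; rewrite le_eqVlt => /predU1P[<-|st].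
  rewrite -[LHS](LIM_cst LIMP); congr LIM; apply/funext => d.
  congr (mean P _); apply/funext => w.
  rewrite subrr mulr0 /compensator big1 ?mulr0// => p.
  by case/andP=> sp ps; move: (lt_le_trans sp ps); rewrite ltxx.
pose d0 := [fset s; t]%fset; pose c := fun (_ : Delta) (_ : T) => 1 : R.
pose f := fun v : T * Delta => \sum_(p <- steps d0) c p.1 v.1 * \1_(ocitv p) v.2.
have bc1 p : p \in steps d0 -> bounded_measurable (F p.1) (c p.1).
  move=> _; split; first by apply: measurable_wrt_cst; exact: FS.
  by exists 1; split; [exact: num_real|move=> r lt1r w _; rewrite /c normr1; exact: ltW].
have Ff : pred_fun F d0 f by exists c.
have bLinf : b \in Lfun P +oo%E by apply/LinftyP; exists C.
have := natA b d0 f bLinf Ff.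
have -> : (fun w => b w * sint d0 f A w) = fun w => b w * (A t w - A s w).
  apply/funext => w; congr (_ * _).
  by rewrite sint_pred_fun /d0 steps_pair// big_seq1 /c mul1r.
move=> ->; apply: (LIM_eq LIMP (d0 := d0)).
- exact: natural_net_bounded bC Ff.
- exact: compensator_net_bounded bC.
- move=> d d0d; rewrite (natural_netE bC bc1 (d := d) d0d) /d0 steps_pair// big_seq1.
  by congr (mean P _); apply/funext => w; rewrite /c mulr1.
Qed.

(** The coefficient of the integrand over a step of [d0] is bounded and can be
    absorbed in the test variable, one step at a time. *)
Lemma compensator_limit_natural : compensator_limit -> natural P F LIM A.
Proof.
move=> limA b d0 f /LinftyP[C bC] Ff.
have [c Fc fE] := Ff.
have bc p : p \in steps d0 -> exists D, ebounded P D (fun w => b w * c p.1 w).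
  move=> pd; have [Fcp /bounded_fun_ex[D cD]] := Fc p pd.
  exists (C * D); apply: eboundedM => //; apply: ebounded_le => //.
  exact: measurable_wrt_measurable FM Fcp.
have bnet p : p \in steps d0 -> bounded_net (fun d => E (fun w => b w * c p.1 w *
    compensator P F X (fun r => p.1 < r <= p.2)%O d w)).
  by move=> pd; have [D bcD] := bc p pd; exact: compensator_net_bounded bcD.
have [bsum LIMsum] := LIM_sum LIMP bnet.
rewrite (LIM_eq LIMP (d0 := d0) (v := fun d => \sum_(p <- steps d0)
    E (fun w => b w * c p.1 w *
    compensator P F X (fun r => p.1 < r <= p.2)%O d w)))//; last 2 first.
- exact: natural_net_bounded bC Ff.
- by move=> d d0d; rewrite fE (natural_netE bC Fc d0d).
rewrite LIMsum fE.
transitivity (E (fun w => \sum_(p <- steps d0 | p \in steps d0)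
    b w * c p.1 w * (A p.2 w - A p.1 w))).
  congr (mean P _); apply/funext => w.
  rewrite sint_pred_fun mulr_sumr big_seq.
  by apply: eq_bigr => p _; rewrite mulrA.
rewrite mean_sum; last first.
  by move=> p pd; have [D bcD] := bc p pd; apply: eboundedMl bcD _; exact: L1B.
rewrite [RHS]big_seq; apply: eq_bigr => p pd.
have [D bcD] := bc p pd; have [p12 _ _] := steps_mem pd.
exact: limA bcD (ltW p12).
Qed.

End process.
End natural_processes.

(** * Finitely additive integrals of indicators, and events of probability one *)

Section finitely_additive_integral.
Context {R : realType} {U : Type}.
Variables (G : set (set U)) (x : set U -> R).
Hypothesis GT : sigma_algebra setT G.
Hypothesis xba : is_ba G x.
Hypothesis x0 : forall B, G B -> 0 <= x B.

Lemma sigma_algebra_setC B : G B -> G (~` B).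
Proof. by have [_ GC _] := GT; rewrite -setTD; exact: GC. Qed.

Lemma sigma_algebra_setU A B : G A -> G B -> G (A `|` B).
Proof.
have [G0 _ GU] := GT; move=> GA GB; rewrite -bigcup2E; apply: GU => -[|[|n]] //=.
Qed.

Lemma sigma_algebra_setI A B : G A -> G B -> G (A `&` B).
Proof.
move=> GA GB; rewrite -[_ `&` _]setCK setCI.
by apply/sigma_algebra_setC/sigma_algebra_setU; exact: sigma_algebra_setC.
Qed.

Let additive A B : G A -> G B -> A `&` B = set0 -> x (A `|` B) = x A + x B.
Proof. by have [+ _] := xba; apply. Qed.

Lemma ba_set0 : x set0 = 0.
Proof.
have [G0 _ _] := GT; have := additive G0 G0 (setI0 _); rewrite setU0 => /eqP.
by rewrite -subr_eq0 opprD addrA subrr sub0r oppr_eq0 => /eqP.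
Qed.

Lemma ba_partition (s : U -> R) B : G B -> measurable_wrt G s ->
  finite_set (range s) ->
  x B = \sum_(v <- fset_set (range s)) x (B `&` s @^-1` [set v]).
Proof.
move=> GB Gs sfin.
have Gv v : G (B `&` s @^-1` [set v]).
  by apply: sigma_algebra_setI => //; apply: Gs; exact: measurable_set1.
have main (l : seq R) : uniq l -> G (B `&` s @^-1` [set` l]) /\
    x (B `&` s @^-1` [set` l]) = \sum_(v <- l) x (B `&` s @^-1` [set v]).
  elim: l => [_|v l IH /= /andP[vl /IH[Gl xl]]].
    rewrite (_ : B `&` _ = set0); last by apply/seteqP; split => w // -[].
    by rewrite big_nil ba_set0; split => //; have [] := GT.
  have -> : B `&` s @^-1` [set` v :: l] =
      (B `&` s @^-1` [set v]) `|` (B `&` s @^-1` [set` l]).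
    rewrite -setIUr; congr (_ `&` _); apply/seteqP; split => w /=.
      by rewrite inE => /predU1P; tauto.
    by rewrite inE => -[->|->]; rewrite ?eqxx ?orbT.
  split; first exact: sigma_algebra_setU.
  rewrite additive// ?big_cons ?xl//.
  apply/seteqP; split => w // -[[_ /= sv] [_ /= sl]].
  by move: vl; rewrite -sv sl.
have [_ <-] := main _ (fset_uniq (fset_set (range s))).
congr (x _); apply/seteqP; split => w; last by case.
move=> Bw; split => //=; rewrite in_fset_set// inE; by exists w.
Qed.

Lemma measurable_wrt_indicator B : G B -> measurable_wrt G (\1_B : U -> R).
Proof.
move=> GB D mD.
rewrite preimage_indic; case: ifPn => _; case: ifPn => _ //.
- exact: sigma_algebra_setT.
- exact: sigma_algebra_setC.
- by have [] := GT.
Qed.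

(** Let the simple function [s] be within [r] of the indicator of [B].  Splitting
    each level set of [s] into its parts inside and outside [B], the integral of
    [s] is seen to be within [r * x setT] of [x B].  The indicator is itself
    simple, so no other number can be its integral. *)
Lemma ba_integral_indic B : G B -> ba_integral G x (\1_B) = x B.
Proof.
move=> GB.
have GBC := sigma_algebra_setC GB.
have fin1 : finite_set (range (\1_B : U -> R)).
  apply: (sub_finite_set (B := [set 0; 1])); last exact: finite_set2.
  by move=> _ [w _ <-]; rewrite indicE; case: (_ \in _); [right|left].
have xB : is_ba_integral G x (\1_B) (x B).
  move=> e e0.
  have xT0 : 0 <= x setT by apply: x0; exact: sigma_algebra_setT.
  have xT1 : 0 < x setT + 1 by rewrite ltr_wpDl.
  (* The added 1 allows for [x setT = 0]. *)
  exists (e / (x setT + 1)); first by rewrite divr_gt0.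
  set r := e / _ => s Gs sfin sr.
  have Gv C v : G C -> G (C `&` s @^-1` [set v]).
    by move=> GC; apply: sigma_algebra_setI => //; apply: Gs; exact: measurable_set1.
  rewrite /ba_simple_integral fsbig_finite//.
  rewrite (ba_partition GB Gs sfin) -sumrB.
  have -> : \sum_(v <- fset_set (range s))
      (v * x (s @^-1` [set v]) - x (B `&` s @^-1` [set v])) =
    \sum_(v <- fset_set (range s)) ((v - 1) * x (B `&` s @^-1` [set v]) +
      v * x (~` B `&` s @^-1` [set v])).
    apply: eq_bigr => v _.
    have -> : x (s @^-1` [set v]) =
        x (B `&` s @^-1` [set v]) + x (~` B `&` s @^-1` [set v]).
      rewrite -additive//; [|exact: Gv..|].
        by rewrite -setIUl setUv setTI.
      by rewrite setIACA setICr set0I.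
    ring.
  have xsmall C (c v : R) : G C -> (forall w, C w -> s w = v -> `|c| <= r) ->
      `|c * x (C `&` s @^-1` [set v])| <= r * x (C `&` s @^-1` [set v]).
    move=> GC cr; have xv0 := x0 (Gv C v GC).
    have [->|/set0P[w [Cw sw]]] := eqVneq (C `&` s @^-1` [set v]) set0.
      by rewrite ba_set0 !mulr0 normr0.
    by rewrite normrM [X in _ * X]ger0_norm// ler_wpM2r// (cr w).
  rewrite (le_trans (ler_norm_sum _ _ _))//.
  apply: (@le_trans _ _ (r * x setT)).
    rewrite (_ : x setT = x B + x (~` B)); last first.
      by rewrite -additive// ?setUv// setICr.
    rewrite (ba_partition GB Gs sfin) (ba_partition GBC Gs sfin) -big_split mulr_sumr.
    apply: ler_sum => v _; rewrite mulrDr (le_trans (ler_normD _ _))// lerD//.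
      apply: xsmall => // w Bw sw; rewrite -sw distrC.
      by have := sr w; rewrite indicE mem_set.
    apply: xsmall => // w Bw sw; rewrite -sw -normrN -sub0r.
    by have := sr w; rewrite indicE memNset.
  by rewrite /r mulrAC ler_pdivrMr// ler_wpM2l ?lerDl// ltW.
apply: get_unique => // I xI.
have simple J : is_ba_integral G x (\1_B) J -> J = ba_simple_integral x (\1_B).
  move=> HJ; apply/eqP; rewrite eq_sym -subr_eq0 -normr_le0; apply/ler_addgt0Pl => e e0.
  have [r r0 Hr] := HJ _ e0; rewrite addr0; apply: Hr => //.
    exact: measurable_wrt_indicator.
  by move=> w; rewrite subrr normr0 ltW.
by rewrite (simple _ xI) (simple _ xB).
Qed.

End finitely_additive_integral.

Section probability_one.
Context {R : realType} {dT : measure_display} {T : measurableType dT}.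
Variable P : probability T R.

Lemma ae_probability1 (S : set T) : measurable S -> P S = 1%E ->
  {ae P, forall w, S w}.
Proof.
move=> mS PS; exists (~` S); split => //; first exact: measurableC.
by rewrite probability_setC// PS subee.
Qed.

Lemma probability1_ae (S : set T) : measure_is_complete P ->
  {ae P, forall w, S w} -> P S = 1%E.
Proof.
move=> cP aeS; have mSC : measurable (~` S) by exact: cP.
have PSC : P (~` S) = 0%E by exact/negligibleP.
by rewrite -[S]setCK probability_setC// PSC sube0.
Qed.

End probability_one.

(** * Potentials *)

Section potentials.
Context {R : realType} {dT : measure_display} {T : measurableType dT}.
Context {disp : Order.disp_t} {Delta : orderType disp}.
Variable P : probability T R.
Variable F : Delta -> set (set T).
Hypothesis filtF : filtration P F.
Variable LIM : ({fset Delta} -> R) -> R.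
Hypothesis LIMP : banach_limit LIM.
Variable X : Delta -> T -> R.
Hypothesis potX : potential P F X.

Local Notation E := (mean P).
Local Notation L1 := (Lfun P 1%:E).
Local Notation cond s := (condexp P (F s)).
Local Notation comp := (compensator P F X).
Local Notation FS := (filtration_sigma_algebra filtF _).
Local Notation FM := (@filtration_measurable _ _ _ _ _ _ _ filtF _).

Lemma potential_adapted : adapted F X.
Proof. by have [[[]]] := potX. Qed.

Lemma potential_L1 s : X s \in L1.
Proof. by have [[[_ + _] _] _ _] := potX; apply. Qed.

Let X1 := potential_L1.
Let aX := potential_adapted.

Lemma potential_mean_ge0 s : 0 <= E (X s).
Proof.
have [_ X0 _] := potX.
by apply: mean_ge0 (X0 s); exact: L1_measurable (X1 s).
Qed.

Lemma potential_drift_ge0 p : (p.1 <= p.2)%O ->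
  {ae P, forall w, 0 <= drift P F X p w}.
Proof.
have [_ _ [_ _ superX]] := potX; move=> /superX.
by apply: filterS => w; rewrite /drift subr_ge0.
Qed.

Lemma potential_mean_le s t : (s <= t)%O -> E (X t) <= E (X s).
Proof.
move=> st; rewrite -subr_ge0 -(mean_drift filtF X1 (s, t)).
apply: mean_ge0 (potential_drift_ge0 _) => //.
exact: L1_measurable (drift_L1 filtF X1 _).
Qed.

Lemma mean_variation d : 'E_P[Defs.variation P F d X]%E = (E (comp predT d))%:E.
Proof.
have d1 p := drift_L1 filtF X1 p.
have vE : Defs.variation P F d X = fun w => \sum_(p <- steps d) `|drift P F X p w| by [].
rewrite vE expectation_mean; last by apply: L1_sum => p _; exact/L1_abs/d1.
congr EFin; rewrite mean_sum; last by move=> p _; exact/L1_abs/d1.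
rewrite /compensator mean_sum//.
rewrite big_seq [RHS]big_seq; apply: eq_bigr => p /steps_mem[p12 _ _].
exact: mean_norm_ge0 (d1 p) (potential_drift_ge0 (ltW p12)).
Qed.

(** The drifts are nonnegative, so the compensator over the whole grid is the
    variation of [X] along it. *)
Lemma potential_compensator_bounded : exists V, forall d, E (comp predT d) <= V.
Proof.
have [[[_ _ supV] _] _ _] := potX.
set B := ereal_sup _ in supV.
have ub d : ((E (comp predT d))%:E <= B)%E.
  by apply: ereal_sup_ubound; exists d => //; exact: mean_variation.
have Bfin : B \is a fin_num.
  rewrite fin_numE; apply/andP; split; last by rewrite lt_eqF.
  by apply: contraTneq (ub fset0) => ->; rewrite leeNy_eq.
by exists (fine B) => d; rewrite -lee_fin (fineK Bfin).
Qed.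

Lemma potential_vanishes (e : R) : 0 < e ->
  exists s, forall t, (s <= t)%O -> E (X t) < e.
Proof.
move=> e0; have [[_ [s_ /(_ s_ (fun=> lexx _)) Xs]] _ _] := potX.
have H : E (fun w => `|X (s_ n) w|) @[n --> \oo] --> (0 : R) by exact: fine_cvg Xs.
have /cvgrPdist_lt := H; move/(_ _ e0) => [n _ /(_ n (leqnn n))] /=.
rewrite sub0r normrN => Xn; exists (s_ n) => t st.
apply: le_lt_trans (potential_mean_le st) _.
apply: le_lt_trans (ler_norm _) _; apply: le_lt_trans (normr_mean (X1 _)) _.
exact: le_lt_trans (ler_norm _) Xn.
Qed.

Let V := sval (cid potential_compensator_bounded).
Let compV d : E (comp predT d) <= V.
Proof. exact: (svalP (cid potential_compensator_bounded)). Qed.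

Lemma potential_net_bounded C (b : T -> R) D : ebounded P C b ->
  bounded_net (fun d => E (fun w => b w * comp D d w)).
Proof. exact: (compensator_net_bounded filtF X1 potential_drift_ge0 compV). Qed.

(** Along a grid containing [s], the drifts after [s] telescope to [X s] minus
    the value of [X] at the last point of the grid, whose mean is small once the
    grid contains a late enough time. *)
Lemma potential_tail_limit C (b : T -> R) s :
  ebounded P C b -> measurable_wrt (F s) b ->
  LIM (fun d => E (fun w => b w * comp (fun r => s < r)%O d w)) =
  E (fun w => b w * X s w).
Proof.
move=> bC Fb.
have net d e s1 : s \in d -> s1 \in d -> (forall t, (s1 <= t)%O -> E (X t) < e) ->
    `|E (fun w => b w * comp (fun r => s < r)%O d w) - E (fun w => b w * X s w)|
      <= `|C| * e.
  move=> sd s1d Xe; have [lo [hi [lod hid lohi]]] := grid_bounds sd.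
  have /andP[_ shi] := lohi _ sd; have /andP[_ s1hi] := lohi _ s1d.
  have -> : comp (fun r => s < r)%O d = comp (fun r => s < r <= hi)%O d.
    apply/funext => w; rewrite /compensator big_seq_cond [RHS]big_seq_cond.
    apply: eq_bigl => p; case: (boolP (p \in steps d)) => //= pd.
    have [_ _ p2] := steps_mem pd.
    by have /andP[_ ->] := lohi _ p2; rewrite andbT.
  rewrite (mean_compensator_between filtF X1 sd hid shi bC Fb) addrAC subrr sub0r normrN.
  rewrite (le_trans (mean_ebounded (ebounded_norm bC) (X1 hi)))// ler_wpM2l//.
  have [_ X0 _] := potX.
  by rewrite (mean_norm_ge0 (X1 hi) (X0 hi)) ltW// Xe.
have bnet := potential_net_bounded (fun r => s < r)%O bC.
apply/eqP; rewrite -subr_eq0 -normr_le0; apply/ler_addgt0Pl => e e0; rewrite addr0.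
have C1 : 0 < `|C| + 1 by rewrite ltr_wpDl.
have [s1 Xs1] := potential_vanishes (divr_gt0 e0 C1).
have Ce : `|C| * (e / (`|C| + 1)) <= e.
  by rewrite mulrA ler_pdivrMr// mulrC ler_wpM2l ?lerDl// ltW.
have near d : ([fset s; s1] `<=` d)%fset ->
    `|E (fun w => b w * comp (fun r => s < r)%O d w) - E (fun w => b w * X s w)| <= e.
  move=> /fsubsetP sd; apply: le_trans Ce; apply: (net _ _ s1) => //.
    by apply: sd; rewrite !inE eqxx.
  by apply: sd; rewrite !inE eqxx orbT.
rewrite ler_distl -(LIM_cst LIMP (_ - e)) -(LIM_cst LIMP (_ + e)).
by apply/andP; split; apply: (LIM_le LIMP (d0 := [fset s; s1]%fset)) => //;
  do ?[exact: bounded_net_cst]; move=> d /near; rewrite ler_distl => /andP[].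
Qed.

(** Over each step, [mean_condexp_increment] moves the projection from the
    indicator of [S] to the increment of [X], which becomes minus the drift. *)
Lemma corresponds_restrF x : Mloc_pos P F x -> corresponds P F LIM x X ->
  forall S, measurable S -> restrF x S = weak_limit P LIM (comp predT) S.
Proof.
move=> [[xba _] x0] corr S mS.
have barS : sigma_algebra setT (barF P (Delta := Delta)) by exact: smallest_sigma_algebra.
have BS : barF P (S `*` [set: Delta]).
  by apply: sub_sigma_algebra; left; exists S, setT.
rewrite /restrF -(ba_integral_indic barS xba x0 BS) corr; last first.
  split; first exact: measurable_wrt_indicator.
  exists 1; split; [exact: num_real|move=> r lt1r v _].
  by rewrite /= indicE normr_nat (le_trans _ (ltW lt1r))// lern1 leq_b1.
have eS := ebounded_indic P mS.
have -> : (fun d => E (sint d (pred_proj P F d \1_(S `*` setT)) X)) =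
    fun d => -1 * E (fun w => \1_S w * comp predT d w).
  apply/funext => d.
  rewrite (mean_mul_compensator filtF X1 _ _ eS) mulN1r -sumrN.
  have sE o t : \1_(S `*` [set: Delta]) (o, t) = \1_S o :> R.
    rewrite !indicE; congr (nat_of_bool _)%:R.
    by apply/idP/idP; rewrite !inE => //= -[].
  have cS p : ebounded P 1 (cond p (\1_S)) by exact: condexp_ebounded FS FM _ _ eS.
  transitivity (E (fun w => \sum_(p <- steps d | p \in steps d)
      cond p.1 (\1_S) w * (X p.2 w - X p.1 w))).
    congr (mean P _); apply/funext => w; rewrite /sint big_seq; apply: eq_bigr => p pd.
    rewrite /pred_proj.
    rewrite (sum_steps_indic (fun q : Delta * Delta =>
      cond q.1 (fun o => \1_(S `*` [set: Delta]) (o, q.2)) w) pd).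
    by congr (condexp _ _ _ _ * _); apply/funext => o; exact: sE.
  rewrite mean_sum; last by move=> p _; apply: eboundedMl (cS p.1) _; exact: L1B.
  rewrite [RHS]big_seq; apply: eq_bigr => p _.
  transitivity (E (fun w => cond p.1 (\1_S) w * 1 * (X p.2 w - X p.1 w))).
    by congr (mean P _); apply/funext => w; rewrite mulr1.
  rewrite (mean_condexp_increment FS FM eS (ebounded1 P))//; last first.
    by apply: measurable_wrt_cst; exact: FS.
  rewrite -mulN1r -meanZ; last by apply: eboundedMl eS _; exact: drift_L1.
  by congr (mean P _); apply/funext => w; rewrite /drift; ring.
by rewrite LIM_scale ?mulN1r ?opprK//; exact: potential_net_bounded eS.
Qed.

End potentials.

(** * The decomposition *)

Section decomposition.
Context {R : realType} {dT : measure_display} {T : measurableType dT}.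
Context {disp : Order.disp_t} {Delta : orderType disp}.
Variable P : probability T R.
Variable F : Delta -> set (set T).
Hypothesis filtF : filtration P F.
Variable LIM : ({fset Delta} -> R) -> R.
Hypothesis LIMP : banach_limit LIM.
Variable X : Delta -> T -> R.
Hypothesis potX : potential P F X.

Local Notation E := (mean P).
Local Notation L1 := (Lfun P 1%:E).
Local Notation cond s := (condexp P (F s)).
Local Notation comp := (compensator P F X).
Local Notation FS := (filtration_sigma_algebra filtF _).
Local Notation FM := (@filtration_measurable _ _ _ _ _ _ _ filtF _).

Let aX := potential_adapted potX.
Let X1 := potential_L1 potX.
Let drift0 := potential_drift_ge0 potX.

Lemma measurable_wrt_all (f : T -> R) : measurable_fun setT f ->
  measurable_wrt measurable f.
Proof. by move=> mf B mB; rewrite -[X in measurable X]setTI; exact: mf. Qed.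

Section doob_meyer_facts.
Variables (M : T -> R) (A : Delta -> T -> R).
Hypothesis dmA : doob_meyer P F LIM X M A.

Lemma doob_meyer_adapted : adapted F A.
Proof. by have [_ [[]]] := dmA. Qed.

Let mA s : measurable_fun setT (A s).
Proof. exact: measurable_wrt_measurable FM (doob_meyer_adapted s). Qed.

Lemma doob_meyer_L1 s : A s \in L1.
Proof.
have [_ [_ intA _] _] := dmA.
apply/L1P/integrableP; split; first exact/measurable_EFinP.
apply: le_lt_trans intA.
apply: ereal_sup_ubound; exists s => //.
by rewrite unlock.
Qed.

Lemma doob_meyer_mono s t : (s <= t)%O -> {ae P, forall w, 0 <= A s w <= A t w}.
Proof.
move=> st; have [_ [[_ incA _] _ _] _] := dmA.
apply: ae_probability1; last exact: incA.
rewrite -[X in measurable X]setTI.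
have := @measurable_and _ T setT (fun w => 0 <= A s w) (fun w => A s w <= A t w).
move=> /(_ (measurable_fun_ler (measurable_cst _) (mA s)) (measurable_fun_ler (mA s) (mA t))).
by move=> /(_ measurableT [set true]); apply.
Qed.

Lemma doob_meyer_le s t : (s <= t)%O -> {ae P, forall w, A s w <= A t w}.
Proof. by move=> /doob_meyer_mono; apply: filterS => w /andP[]. Qed.

Lemma doob_meyer_ge0 s : {ae P, forall w, 0 <= A s w}.
Proof. by have := doob_meyer_mono (lexx s); apply: filterS => w /andP[]. Qed.

Lemma doob_meyer_mean_ge0 s : 0 <= E (A s).
Proof. exact: mean_ge0 (mA s) (doob_meyer_ge0 s). Qed.

Lemma doob_meyer_mean_le s t : (s <= t)%O -> E (A s) <= E (A t).
Proof. by move=> st; apply: le_mean (doob_meyer_le st); exact: doob_meyer_L1. Qed.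

Lemma doob_meyer_inf (e : R) : 0 < e -> exists s, E (A s) < e.
Proof.
move=> e0; have [_ [[_ _ infA] _ _] _] := dmA.
have : (ereal_inf (range (fun s => 'E_P[A s]%E)) < e%:E)%E by rewrite infA lte_fin.
move=> /ereal_inf_lt[_ [s _ <-]].
by rewrite expectation_mean ?doob_meyer_L1// lte_fin => ?; exists s.
Qed.

Lemma doob_meyer_sup : exists K, [/\ 0 <= K, forall s, E (A s) <= K &
  forall e : R, 0 < e -> exists s, K - e < E (A s)].
Proof.
have [_ [_ intA _] _] := dmA.
have [s0 _] := doob_meyer_inf ltr01.
have ubE : has_ubound (range (fun s => E (A s))).
  rewrite /integrable_process in intA; set B := ereal_sup _ in intA.
  have ub s : ((E (A s))%:E <= B)%E.
    have AB : ('E_P[fun w => `|A s w|%R] <= B)%E.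
      by apply: ereal_sup_ubound; exists s.
    apply: le_trans AB; rewrite expectation_mean ?L1_abs ?doob_meyer_L1// lee_fin.
    by rewrite (le_trans (ler_norm _))// normr_mean// doob_meyer_L1.
  have Bfin : B \is a fin_num.
    rewrite fin_numE; apply/andP; split; last by rewrite lt_eqF.
    by apply: contraTneq (ub s0) => ->; rewrite leeNy_eq.
  by exists (fine B) => _ [s _ <-]; rewrite -lee_fin (fineK Bfin).
have hs : has_sup (range (fun s => E (A s))) by split => //; exists (E (A s0)), s0.
have ubs s : E (A s) <= sup (range (fun s => E (A s))).
  by apply: ub_le_sup => //; exists s.
exists (sup (range (fun s => E (A s)))); split => //.
  exact: le_trans (doob_meyer_mean_ge0 s0) (ubs s0).
by move=> e e0; have [_ [s _ <-] ?] := sup_adherent e0 hs; exists s.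
Qed.

Lemma doob_meyer_drift p : (p.1 <= p.2)%O ->
  {ae P, forall w, drift P F X p w = cond p.1 (A p.2) w - A p.1 w}.
Proof.
have [[M1 _] _ XE] := dmA => p12.
apply: (drift_decomposition filtF p12 _ _ M1 X1 XE).
- exact: doob_meyer_adapted.
- exact: doob_meyer_L1.
Qed.

(** The limit on the right is computed from [X] alone: this is what makes the
    decomposition unique. *)
Lemma doob_meyer_limit : compensator_limit P F LIM X A.
Proof.
have [_ [_ _ natA] _] := dmA.
have [K [K0 AK _]] := doob_meyer_sup.
have [V compV] := potential_compensator_bounded filtF potX.
apply: (natural_compensator_limit filtF LIMP X1 doob_meyer_adapted doob_meyer_L1
  doob_meyer_drift doob_meyer_le K0 _ drift0 compV natA).
by move=> s; rewrite doob_meyer_mean_ge0 AK.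
Qed.

Lemma doob_meyer_mean_compensator D d :
  E (comp D d) = \sum_(p <- steps d | D p.2) (E (A p.2) - E (A p.1)).
Proof.
rewrite mean_sum; last by move=> p _; exact: drift_L1.
rewrite big_seq_cond [RHS]big_seq_cond; apply: eq_bigr => p /andP[/steps_mem[p12 _ _] _].
have A1 := doob_meyer_L1.
have c1 : cond p.1 (A p.2) \in L1 by exact: cond_L1.
rewrite -(mean_condexp (filtration_sigma_algebra filtF p.1) FM (A1 p.2)) -meanB//.
apply: mean_ae_eq.
- exact/L1_measurable/drift_L1.
- by apply: (@L1_measurable _ _ _ P); exact: L1B.
- exact: doob_meyer_drift (ltW p12).
Qed.

(** The interval [s, t] is chosen so that the mean of [A] is less than [e / 3]
    at [s] and within [e / 3] of its supremum at [t].  The drifts over the steps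
    inside it contribute the measure with the integrable density [A t - A s] in
    the limit, the other ones at most [2 * e / 3] in mean along every grid that
    contains [s] and [t]. *)
Lemma doob_meyer_abs_continuous :
  fa_abs_continuous P (weak_limit P LIM (comp predT)).
Proof.
move=> e e0.
have A1 := doob_meyer_L1.
have e3 : 0 < e / 3 by rewrite divr_gt0.
have [K [K0 AK Ksup]] := doob_meyer_sup.
have [s0 As0] := doob_meyer_inf e3.
have [t0 At0] := Ksup _ e3.
pose s := Order.min s0 t0; pose t := Order.max s0 t0.
have st : (s <= t)%O by rewrite /s /t ge_min !le_max lexx.
have As : E (A s) < e / 3.
  by apply: le_lt_trans As0; apply: doob_meyer_mean_le; rewrite /s ge_min lexx.
have At : K - e / 3 < E (A t).
  by apply: lt_le_trans At0 _; apply: doob_meyer_mean_le; rewrite /t le_max lexx orbT.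
have Y1 : (fun w => A t w - A s w) \in L1 by exact: L1B.
have /L1P Yint := Y1.
have [eta [eta0 Heta]] := integral_normr_continuous Yint e3.
exists eta => // S mS PS.
have eS := ebounded_indic P mS.
have SY : E (fun w => \1_S w * (A t w - A s w)) < e / 3.
  apply: le_lt_trans (Heta S mS PS).
  rewrite -[leRHS]/(fine (\int[P]_(w in S) (`|A t w - A s w|)%:E)%E).
  have mT : measurable `<=` @measurable _ T by [].
  rewrite (integral_mean mT)//; last exact: L1_abs.
  apply: le_mean; [exact: eboundedMl eS Y1|exact: eboundedMl eS (L1_abs Y1)|].
  by apply/nearW => w; rewrite ler_wpM2l// ler_norm.
pose Dst := fun r => (s < r <= t)%O.
have bnet D := potential_net_bounded filtF potX D eS.
have bd : bounded_net (fun d => E (fun w => \1_S w * comp Dst d w) + 2 * e / 3).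
  have := bounded_net_lin 1 1 (bnet Dst) (bounded_net_cst (2 * e / 3)).
  by under eq_fun do rewrite !mul1r.
apply: (@le_lt_trans _ _ (LIM (fun d => E (fun w => \1_S w * comp Dst d w) + 2 * e / 3))).
  apply: (LIM_le LIMP (d0 := [fset s; t]%fset)) => // d /fsubsetP std.
  have sd : s \in d by apply: std; rewrite !inE eqxx.
  have td : t \in d by apply: std; rewrite !inE eqxx orbT.
  have -> : (fun w => \1_S w * comp predT d w) = fun w =>
      \1_S w * comp Dst d w + \1_S w * comp (fun r => ~~ Dst r) d w.
    by apply/funext => w; rewrite -mulrDr (compensator_split P F X predT Dst).
  have c1 D := compensator_L1 filtF X1 D d.
  rewrite meanD; [|exact: eboundedMl eS (c1 _)..].
  rewrite lerD2l; apply: (@le_trans _ _ (E (comp (fun r => ~~ Dst r) d))).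
    apply: le_mean => //; first exact: eboundedMl eS (c1 _).
    apply: filterS (compensator_ge0 drift0 (fun r => ~~ Dst r) d) => w c0.
    by rewrite indicE; case: (_ \in _); rewrite /= ?mul1r ?mul0r.
  have sumE : E (comp predT d) = E (comp Dst d) + E (comp (fun r => ~~ Dst r) d).
    rewrite -meanD//; congr (mean P _); apply/funext => w.
    exact: (compensator_split P F X predT Dst).
  have tot : E (comp predT d) <= K.
    rewrite doob_meyer_mean_compensator.
    apply: (steps_variation_le (g := fun r => E (A r))) => // r.
    by rewrite doob_meyer_mean_ge0 AK.
  have mid : E (comp Dst d) = E (A t) - E (A s).
    by rewrite doob_meyer_mean_compensator (steps_telescope (fun r => E (A r))).
  by move: sumE tot; rewrite mid; lra.
rewrite (LIM_add LIMP (bnet Dst) (bounded_net_cst _)) (LIM_cst LIMP).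
rewrite -(doob_meyer_limit eS st); move: SY; lra.
Qed.

End doob_meyer_facts.

(** By [doob_meyer_limit] the two processes have the same increments from a time
    [q] to [s], and [q] can be chosen so that both have small mean at [q]. *)
Lemma doob_meyer_unique M M' A A' s :
  doob_meyer P F LIM X M A -> doob_meyer P F LIM X M' A' ->
  {ae P, forall w, A s w = A' s w}.
Proof.
move=> dA dA'.
have A1 := doob_meyer_L1 dA; have A1' := doob_meyer_L1 dA'.
have sT := @sigma_algebra_measurable _ T.
have mT : measurable `<=` @measurable _ T by [].
apply: (ae_eq_of_mean sT mT).
- exact: measurable_wrt_all (L1_measurable (A1 s)).
- exact: measurable_wrt_all (L1_measurable (A1' s)).
- exact: A1.
- exact: A1'.
move=> B mB; have eB := ebounded_indic P mB.
apply/eqP; rewrite -subr_eq0 -normr_le0; apply/ler_addgt0Pl => e e0; rewrite addr0.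
have e2 : 0 < e / 2 by rewrite divr_gt0.
have [r Ar] := doob_meyer_inf dA e2; have [r' Ar'] := doob_meyer_inf dA' e2.
pose q := Order.min s (Order.min r r').
have qs : (q <= s)%O by rewrite /q ge_min lexx.
have Aq : E (A q) < e / 2.
  by apply: le_lt_trans Ar; apply: (doob_meyer_mean_le dA); rewrite /q !ge_min lexx orbT.
have Aq' : E (A' q) < e / 2.
  by apply: le_lt_trans Ar'; apply: (doob_meyer_mean_le dA'); rewrite /q !ge_min lexx !orbT.
have IL (Y : T -> R) : Y \in L1 -> (fun w => \1_B w * Y w) \in L1 by exact: eboundedMl eB.
have bound M0 A0 : doob_meyer P F LIM X M0 A0 ->
    0 <= E (fun w => \1_B w * A0 q w) <= E (A0 q).
  move=> d0; have A01 := doob_meyer_L1 d0 q.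
  apply/andP; split.
    apply: mean_ge0; first exact: L1_measurable (IL _ A01).
    by apply: filterS (doob_meyer_ge0 d0 q) => w ?; rewrite mulr_ge0.
  apply: le_mean => //; first exact: IL.
  apply: filterS (doob_meyer_ge0 d0 q) => w A0q.
  by rewrite indicE; case: (_ \in _); rewrite /= ?mul1r ?mul0r.
have incr M0 A0 : doob_meyer P F LIM X M0 A0 ->
    E (fun w => \1_B w * (A0 s w - A0 q w)) =
    E (fun w => \1_B w * A0 s w) - E (fun w => \1_B w * A0 q w).
  move=> d0; have A01 := doob_meyer_L1 d0.
  by under eq_fun do rewrite mulrBr; rewrite meanB//; exact: IL.
have := doob_meyer_limit dA eB qs; rewrite -(doob_meyer_limit dA' eB qs).
rewrite (incr _ _ dA) (incr _ _ dA').
have /andP[? ?] := bound _ _ dA; have /andP[? ?] := bound _ _ dA'.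
move=> H; rewrite ler_norml; apply/andP; split; lra.
Qed.

(** [M] and [B t] are the weak limits of the compensators over the whole grid and
    up to time [t].  The compensator up to [t] does not see the difference between
    a test variable and its projection on [F t], so neither does [B t], which
    therefore has the [F t]-measurable version [A t]. *)
Lemma doob_meyer_exists : measure_is_complete P ->
  fa_abs_continuous P (weak_limit P LIM (comp predT)) ->
  exists (M : T -> R) (A : Delta -> T -> R), doob_meyer P F LIM X M A.
Proof.
move=> cP acT.
have [V compV] := potential_compensator_bounded filtF potX.
have c1 D d := compensator_L1 filtF X1 D d.
have c0 D d := compensator_ge0 drift0 D d.
have cV D d : E (comp D d) <= V.
  exact: le_trans (mean_compensator_le filtF X1 drift0 _ _) (compV _).
have bnet C (b : T -> R) D : ebounded P C b ->
    bounded_net (fun d => E (fun w => b w * comp D d w)).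
  by move=> bC; exact: (potential_net_bounded filtF potX D bC).
have sT := @sigma_algebra_measurable _ T.
have mT : measurable `<=` @measurable _ T by [].
have IL S (Y : T -> R) : measurable S -> Y \in L1 -> (fun w => \1_S w * Y w) \in L1.
  by move=> mS; exact: eboundedMl (ebounded_indic P mS).
have cle (D D' : pred Delta) d : (forall r, D r -> D' r) ->
    {ae P, forall w, comp D d w <= comp D' d w}.
  move=> DD'; have := c0 (fun r => D' r && ~~ D r) d; apply: filterS => w c0w.
  rewrite (compensator_split P F X D' D).
  rewrite (_ : (fun r => D' r && D r) = D) ?lerDl//.
  by apply/funext => r; case: (boolP (D r)) => Dr; rewrite ?andbF// DD'.
have cleS (D D' : pred Delta) S d : (forall r, D r -> D' r) -> measurable S ->
    E (fun w => \1_S w * comp D d w) <= E (fun w => \1_S w * comp D' d w).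
  move=> DD' mS; apply: le_mean; [exact: IL|exact: IL|].
  by apply: filterS (cle D D' d DD') => w ?; rewrite ler_wpM2l.
have [M [M1 M0 ME]] := weak_limit_density LIMP (c1 predT) (c0 predT) (cV predT) acT.
have BP t : exists B : T -> R, [/\ B \in L1, {ae P, forall w, 0 <= B w} &
    forall C b, ebounded P C b -> E (fun w => b w * B w) =
      LIM (fun d => E (fun w => b w * comp (fun r => r <= t)%O d w))].
  apply: (weak_limit_density LIMP (c1 _) (c0 _) (cV _)).
  move=> e e0; have [eta eta0 Heta] := acT e e0; exists eta => // S mS PS.
  apply: le_lt_trans (Heta S mS PS).
  apply: (LIM_le LIMP (d0 := fset0)); [exact: bnet (ebounded_indic P mS)..|].
  by move=> d _; exact: cleS.
have {BP} [B BP] := choice BP.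
have B1 t : B t \in L1 by have [] := BP t.
have B0 t : {ae P, forall w, 0 <= B t w} by have [] := BP t.
have BE t C b : ebounded P C b -> E (fun w => b w * B t w) =
      LIM (fun d => E (fun w => b w * comp (fun r => r <= t)%O d w)).
  by have [_ _] := BP t; apply.
pose A t := cond t (B t).
have A1 t : A t \in L1 by exact: cond_L1.
have aA : adapted F A by move=> t; exact: cond_measurable.
have mA t := L1_measurable (A1 t).
have mulC (f g : T -> R) : (fun w => f w * g w) = fun w => g w * f w.
  by apply/funext => w; rewrite mulrC.
have project t S (Y : T -> R) : measurable S -> Y \in L1 -> measurable_wrt (F t) Y ->
    E (fun w => cond t (\1_S) w * Y w) = E (fun w => \1_S w * Y w).
  move=> mS Y1 FY; have eS := ebounded_indic P mS.
  have ceS := condexp_ebounded FS FM eS : ebounded P 1 (cond t (\1_S)).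
  rewrite mulC [in RHS]mulC.
  apply: (mean_mul_condexp FS FM) => //; rewrite 1?mulC.
  - exact: ebounded_L1 eS.
  - exact: IL.
  - exact: eboundedMl ceS Y1.
have BA t : {ae P, forall w, B t w = A t w}.
  apply: (ae_eq_of_mean sT mT) => //.
  - exact: measurable_wrt_all (L1_measurable (B1 t)).
  - exact: measurable_wrt_all.
  move=> S mS; have eS := ebounded_indic P mS.
  have ceS := condexp_ebounded FS FM eS : ebounded P 1 (cond t (\1_S)).
  rewrite -(project t S (A t) mS (A1 t) (aA t)).
  rewrite (mean_mul_condexp FS FM (B1 t)); last 3 first.
  - by apply: cond_measurable => //; exact: ebounded_L1 eS.
  - exact: eboundedMl ceS (B1 t).
  - exact: eboundedMl ceS (A1 t).
  rewrite (BE _ _ _ eS) (BE _ _ _ ceS); congr LIM; apply/funext => d.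
  by rewrite project//; exact: compensator_measurable.
have AE t C b : ebounded P C b -> E (fun w => b w * A t w) =
      LIM (fun d => E (fun w => b w * comp (fun r => r <= t)%O d w)).
  move=> bC; rewrite -(BE _ _ _ bC); have [mb _] := bC.
  apply: mean_ae_eq; [exact: measurable_funM|apply: measurable_funM => //|].
    exact: L1_measurable (B1 t).
  by apply: filterS (BA t) => w ->.
have A0 t : {ae P, forall w, 0 <= A t w} by apply: filterS2 (B0 t) (BA t) => w ? <-.
have Amono s t : (s <= t)%O -> {ae P, forall w, A s w <= A t w}.
  move=> st; apply: (ae_le_of_mean sT mT) => //; [exact: measurable_wrt_all..|].
  move=> S mS; have eS := ebounded_indic P mS.
  rewrite !(AE _ _ _ eS); apply: (LIM_le LIMP (d0 := fset0)); [exact: bnet eS..|].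
  by move=> d _; apply: cleS => // r /le_trans; exact.
have XE t : {ae P, forall w, X t w = cond t M w - A t w}.
  have cM1 : cond t M \in L1 by exact: cond_L1.
  apply: (ae_eq_of_mean (filtration_sigma_algebra filtF t) FM) => //.
  - by apply: measurable_wrtB => //; [exact: FS|exact: cond_measurable].
  - exact: L1B.
  move=> S FS'; have mS := FM FS'; have eS := ebounded_indic P mS.
  under [in RHS]eq_fun do rewrite mulrBr.
  rewrite meanB; [|exact: IL..].
  rewrite (mean_condexp_set FS FM FS' M1) (ME _ _ eS) (AE _ _ _ eS).
  rewrite -(LIM_sub LIMP); [|exact: bnet eS..].
  rewrite -(potential_tail_limit filtF LIMP potX eS); last first.
    by apply: measurable_wrt_indic => //; exact: FS.
  congr LIM; apply/funext => d; rewrite -meanB; [|exact: IL..].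
  congr (mean P _); apply/funext => w.
  rewrite (compensator_split P F X predT (fun r => r <= t)%O) /= mulrDr addrC addKr.
  by congr (_ * _); rewrite /compensator; apply: eq_bigl => p; rewrite ltNge.
have eT := ebounded1 P.
have e1 (f : T -> R) : (fun w => 1 * f w) = f by apply/funext => w; rewrite mul1r.
have EM : E M = LIM (fun d => E (comp predT d)).
  by have := ME _ _ eT; rewrite e1; under [in RHS]eq_fun do rewrite e1.
have EA t : E (A t) = LIM (fun d => E (comp (fun r => r <= t)%O d)).
  by have := AE t _ _ eT; rewrite e1; under [in RHS]eq_fun do rewrite e1.
have bE D : bounded_net (fun d => E (comp D d)).
  by have := bnet _ _ D eT; under [in X in X -> _]eq_fun do rewrite e1.
have EAM t : E (A t) = E M - E (X t).
  rewrite -(mean_condexp (filtration_sigma_algebra filtF t) FM M1).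
  have cM1 : cond t M \in L1 by exact: cond_L1.
  have : E (X t) = E (fun w => cond t M w - A t w).
    apply: mean_ae_eq (XE t); first exact: L1_measurable (X1 t).
    by apply: (@L1_measurable _ _ _ P); exact: L1B.
  by rewrite meanB// => ->; rewrite opprB addrC subrK.
have EA0 t : 0 <= E (A t) by apply: mean_ge0.
have EAV t : E (A t) <= V.
  rewrite EA -[leRHS](LIM_cst LIMP); apply: (LIM_le LIMP (d0 := fset0)) => //.
  exact: bounded_net_cst.
have [s0 _] := potential_vanishes filtF potX ltr01.
have V0 : 0 <= V := le_trans (EA0 s0) (EAV s0).
exists M, A; split => //.
split.
- split => //.
    move=> s t st; apply: probability1_ae => //.
    by apply: filterS2 (A0 s) (Amono s t st) => w ? ?; apply/andP.
  apply/eqP; rewrite eq_le; apply/andP; split; last first.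
    apply: le_ereal_inf_tmp => _ [s _ <-].
    by rewrite expectation_mean// lee_fin.
  apply/lee_addgt0Pr => e e0; rewrite add0e.
  have [s As] : exists s, E (A s) <= e.
    (* Otherwise the means of [X] stay below the mean of [M] by [e]; but the
       latter is the limit of the differences of the means of [X] at the two
       ends of the grid. *)
    apply: contrapT => noS.
    have XM s : E (X s) <= E M - e.
      have : ~ (E (A s) <= e) by move=> As; apply: noS; exists s.
      by move=> /negP; rewrite -ltNge EAM; lra.
    suff : E M <= E M - e by lra.
    rewrite {1}EM -[leRHS](LIM_cst LIMP).
    apply: (LIM_le LIMP (d0 := [fset s0]%fset)) => //; first exact: bounded_net_cst.
    move=> d; rewrite fsub1set => s0d.
    have [lo [hi [lod hid lohi]]] := grid_bounds s0d.
    have /andP[_ lehi] := lohi _ lod.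
    apply: le_trans (XM lo); rewrite -[leRHS]subr0.
    apply: (@le_trans _ _ (E (X lo) - E (X hi))).
      rewrite -(mean_compensator_between1 filtF X1 lod hid lehi) /compensator.
      rewrite !mean_sum; [|by move=> p _; exact: drift_L1..].
      rewrite big_seq [leRHS]big_seq_cond le_eqVlt; apply/orP; left; apply/eqP.
      apply: eq_bigl => p; case: (boolP (p \in steps d)) => //= pd.
      have [p12 p1 p2] := steps_mem pd.
      have /andP[lop1 _] := lohi _ p1; have /andP[_ ->] := lohi _ p2.
      by rewrite (le_lt_trans lop1 p12).
    by rewrite lerB// (potential_mean_ge0 potX).
  apply: ge_ereal_inf; exists ('E_P[A s])%E; first by exists s.
  by rewrite expectation_mean// lee_fin.
- apply: (@le_lt_trans _ _ V%:E); last exact: ltry.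
  apply: ge_ereal_sup => _ [s _ <-].
  by rewrite expectation_mean ?L1_abs// lee_fin mean_norm_ge0.
- have driftA p : (p.1 <= p.2)%O ->
      {ae P, forall w, drift P F X p w = cond p.1 (A p.2) w - A p.1 w}.
    by move=> p12; exact: (drift_decomposition filtF p12 aA A1 M1 X1 XE).
  apply: (compensator_limit_natural filtF LIMP X1 aA A1 driftA Amono V0 _ drift0 compV).
    by move=> s; rewrite EA0 EAV.
  move=> C b s t bC st.
  under eq_fun do rewrite mulrBr.
  rewrite meanB; [|exact: eboundedMl bC _..].
  rewrite !(AE _ _ _ bC) -(LIM_sub LIMP); [|exact: bnet bC..].
  congr LIM; apply/funext => d; rewrite -meanB; [|exact: eboundedMl bC (c1 _ _)..].
  by congr (mean P _); apply/funext => w; rewrite -mulrBr compensator_diff.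
Qed.

End decomposition.

Theorem theorem2 (R : realType) (dT : measure_display) (T : measurableType dT)
    (P : probability T R) (disp : Order.disp_t) (Delta : orderType disp)
    (F : Delta -> set (set T)) (LIM : ({fset Delta} -> R) -> R)
    (x : set (T * Delta) -> R) (X : Delta -> T -> R) :
  measure_is_complete P ->
  filtration P F ->
  banach_limit LIM ->
  Mloc_pos P F x ->
  potential P F X ->
  corresponds P F LIM x X ->
  (fa_abs_continuous P (restrF x) <->
   exists (M : T -> R) (A : Delta -> T -> R), doob_meyer P F LIM X M A) /\
  (forall (M M' : T -> R) (A A' : Delta -> T -> R),
     doob_meyer P F LIM X M A -> doob_meyer P F LIM X M' A' ->
     modification P (fun s => condexp P (F s) M)
                    (fun s => condexp P (F s) M') /\
     modification P A A').
Proof.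
move=> cP filtF LIMP xM potX corr.
have xE := corresponds_restrF filtF LIMP potX xM corr.
split.
  split=> [ac|[M [A dmA]]].
    apply: (doob_meyer_exists filtF LIMP potX cP) => e e0.
    have [eta eta0 Heta] := ac e e0; exists eta => // S mS PS.
    by rewrite -xE//; exact: Heta.
  move=> e e0; have [eta eta0 Heta] := doob_meyer_abs_continuous filtF LIMP potX dmA e0.
  by exists eta => // S mS PS; rewrite xE//; exact: Heta.
move=> M M' A A' dmA dmA'.
have AA' s := doob_meyer_unique filtF LIMP potX s dmA dmA'.
split=> s; apply: probability1_ae => //; last exact: AA'.
have [_ _ XE] := dmA; have [_ _ XE'] := dmA'.
apply: filterS2 (AA' s) (filterI (XE s) (XE' s)) => w As [Xw Xw'].
by move: Xw; rewrite Xw' As => /(addIr (- A' s w)).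
Qed.
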